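(* Let the assumptions on the data $(\xi^\pi,F^\pi,C^\pi,H)$ listed in the context hold (with $p=2$), and let $(\widetilde{\mathcal Y}^{\Re,\pi},\mathcal Y^{\Re,\pi},\mathcal Z^{\Re,\pi})$ be the solution of the obliquely reflected backward scheme. For any $j\in\mathcal I$ and $0\le i\le n$: (i) $\mathcal U^{\Re,\pi,a}_i-\mathcal A^a_i\le(\mathcal Y^{\Re,\pi}_i)^j$ $\mathbb P$-a.s., for any $a\in\mathscr A^{\Re,\pi}_{i,j}$. (ii) Define the strategy $\bar a^{\Re,\pi}=(\bar\theta_r,\bar\alpha_r)_{r\ge0}$ recursively by $(\bar\theta_0,\bar\alpha_0):=(i,j)$ and, for $r\ge1$, $$\bar\theta_r:=\inf\Big\{k\in\{\bar\theta_{r-1},\dots,n\}\ \Big|\ t_k\in\Re,\ (\widetilde{\mathcal Y}^{\Re,\pi}_k)^{\bar\alpha_{r-1}}\le\max_{m\ne\bar\alpha_{r-1}}\{(\widetilde{\mathcal Y}^{\Re,\pi}_k)^m-(C^\pi_{t_k})^{\bar\alpha_{r-1}m}\}\Big\},$$ $$\bar\alpha_r:=\min\Big\{\ell\ne\bar\alpha_{r-1}\ \Big|\ (\widetilde{\mathcal Y}^{\Re,\pi}_{\bar\theta_r})^\ell-(C^\pi_{t_{\bar\theta_r}})^{\bar\alpha_{r-1}\ell}=\max_{m\ne\bar\alpha_{r-1}}\{(\widetilde{\mathcal Y}^{\Re,\pi}_{\bar\theta_r})^m-(C^\pi_{t_{\bar\theta_r}})^{\bar\alpha_{r-1}m}\}\Big\}.$$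 Then $\bar a^{\Re,\pi}\in\mathscr A^{\Re,\pi}_{i,j}$ and $$(\mathcal Y^{\Re,\pi}_i)^j=\mathcal U^{\Re,\pi,\bar a^{\Re,\pi}}_i-\mathcal A^{\bar a^{\Re,\pi}}_i\qquad\mathbb P\text{-a.s.}$$ (iii) The following Snell envelope representation holds: $$(\mathcal Y^{\Re,\pi}_i)^j=\operatorname*{ess\,sup}_{a\in\mathscr A^{\Re,\pi}_{i,j}}\left(\mathcal U^{\Re,\pi,a}_i-\mathcal A^a_i\right)\qquad\mathbb P\text{-a.s.}$$
   Context: Fix $T>0$, $d\ge1$, $\mathcal I=\{1,\dots,d\}$, and a probability space with a $d$-dimensional Brownian motion and its filtration $(\mathcal F_t)_{t\le T}$; $\mathbb E_t[\cdot]=\mathbb E[\cdot|\mathcal F_t]$. $\mathcal M^{n,m}$ denotes real $n\times m$ matrices; $z^{j\cdot}$ is the $j$th row of $z$. Grids: $\pi=\{0=t_0<\dots<t_n=T\}$, $h_i=t_{i+1}-t_i$, and $\Re=\{0=r_0<\dots<r_\kappa=T\}\subset\pi$. Data. $C^\pi=(C^{\pi,ij})_{i,j\in\mathcal I}$ is a matrix-valued adapted càdlàg process; put $\mathcal Q^\pi_t=\{y\in\mathbb R^d:y^i\ge\max_{j}(y^j-(C^\pi_t)^{ij}),\ 1\le i\le d\}$ and $\mathcal P^\pi_t(y)=(\max_{j\in\mathcal I}\{y^j-(C^\pi_t)^{ij}\})_{1\le i\le d}$. $\xi^\pi$ is a square integrable $\mathcal F_T$-measurable random variable with values in $\mathcal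 Q^\pi_T$. $(H_i)_{0\le i<n}$ are independent random row vectors in $\mathbb R^{1\times d}$, $H_i$ is $\mathcal F_{t_{i+1}}$-measurable, $\mathbb E_{t_i}[H_i]=0$, $\lambda_iI_{d\times d}=h_i\mathbb E[H_i^\top H_i]=h_i\mathbb E_{t_i}[H_i^\top H_i]$ with $\lambda/d\le\lambda_i\le\Lambda/d$ for positive constants $\lambda,\Lambda$. Assumptions (for a given $p\ge2$): (i) $F^\pi_i:\Omega\times\mathcal M^{d,d}\to\mathbb R^d$ is $\mathcal F_{t_i}\otimes\mathcal B(\mathcal M^{d,d})$-measurable, $0\le i\le n-1$; (ii) $C^{\pi,ii}=0$, $\inf_tC^{\pi,ij}_t\ge\varepsilon>0$ for $i\ne j$, $\inf_t\{C^{\pi,ij}_t+C^{\pi,jl}_t-C^{\pi,il}_t\}>0$ for $i\ne j$, $j\ne l$; (iii) $F^{\pi,j}_i(z)=F^{\pi,j}_i(z^{j\cdot})$; (iv) $|F^\pi_i(z)-F^\pi_i(z')|\le L^Z|z-z'|$; (v) $\mathbb E[|\xi^\pi|^2+\sum_{i=0}^{n-1}|F^\pi_i(0)|^2h_i+\sup_{t_i\in\Re}|C^\pi_{t_i}|^p]\le C_p$; (vi) $\sup_{0\le i\le n-1}h_i|H_i|L^Z\le1$. Obliquely reflected backward scheme: $\mathcal Y^{\Re,\pi}_n=\widetilde{\mathcal Y}^{\Re,\pi}_n=\xi^\pi$ and for $0\le i<n$: $\mathcal Z^{\Re,\pi}_i=\mathbb E[\mathcal Y^{\Re,\pi}_{i+1}H_i|\mathcal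 F_{t_i}]$, $\widetilde{\mathcal Y}^{\Re,\pi}_i=\mathbb E[\mathcal Y^{\Re,\pi}_{i+1}|\mathcal F_{t_i}]+h_iF^\pi_i(\mathcal Z^{\Re,\pi}_i)$, $\mathcal Y^{\Re,\pi}_i=\widetilde{\mathcal Y}^{\Re,\pi}_i\mathbf 1_{\{t_i\notin\Re\}}+\mathcal P^\pi_{t_i}(\widetilde{\mathcal Y}^{\Re,\pi}_i)\mathbf 1_{\{t_i\in\Re\}}$. Switching strategies: a strategy $a=(\theta_r,\alpha_r)_{r\in\mathbb N}$ is a nondecreasing sequence of $\mathbb N$-valued stopping times (with respect to $(\mathcal F_{t_k})_k$) with $\mathcal I$-valued $\alpha_r$, $\alpha_r$ being $\mathcal F_{t_{\theta_r}}$-measurable (values $\theta_r>n$ mean no switch; $\inf\emptyset:=n+1$, $\mathcal F_{t_k}:=\mathcal F_T$ for $k>n$, and $\alpha_r$ is irrelevant when $\theta_r>n$). $\mathcal N^a=\#\{r\ge1:\theta_r\le n\}$; the state is $a_k=\alpha_0$ for $k<\theta_0$ and $a_k=\alpha_r$ for $\theta_r\le k<\theta_{r+1}$; the cumulative cost is $\mathcal A^a_k=\sum_{r=1}^{\mathcal N^a}(C^\pi_{t_{\theta_r}})^{\alpha_{r-1}\alpha_r}\mathbf 1_{\{\theta_r\le k\}}$, $0\le k\le n$. $\mathscr A^{\Re,\pi}_{i,j}$ is the set of strategies with $\theta_0=i$, $\alpha_0=j$, $t_{\theta_r}\in\Re$ for $1\le r\le\mathcal N^a$, and $\mathbb E[|\mathcal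 A^a_n|^2]<\infty$. Switched backward scheme: for $a\in\mathscr A^{\Re,\pi}_{i,j}$, $(\mathcal U^{\Re,\pi,a},\mathcal V^{\Re,\pi,a})$ is defined by $\mathcal U^{\Re,\pi,a}_n=\xi^{\pi,a_n}$ and, for $i\le k<n$, $\mathcal V^{\Re,\pi,a}_k=\mathbb E_{t_k}[(\mathcal U^{\Re,\pi,a}_{k+1}-\mathcal A^a_{k+1}+\mathcal A^a_k)H_k]$ and $\mathcal U^{\Re,\pi,a}_k=\mathbb E_{t_k}[\mathcal U^{\Re,\pi,a}_{k+1}-\mathcal A^a_{k+1}+\mathcal A^a_k]+h_kF^{\pi,a_k}_k(\mathcal V^{\Re,\pi,a}_k)$, where $F^{\pi,j}_k(v)$ for a row vector $v$ is $F^{\pi,j}_k$ evaluated at a matrix with $j$th row $v$. Equivalently $\mathcal U_k=\xi^{\pi,a_n}+\sum_{m=k}^{n-1}F^{\pi,a_m}_m(\mathcal V_m)h_m-\sum_{m=k}^{n-1}h_m\lambda_m^{-1}\mathcal V_mH_m^\top-\sum_{m=k}^{n-1}\Delta\mathcal M^a_m-\mathcal A^a_n+\mathcal A^a_k$ with $\Delta\mathcal M^a_m$ $\mathcal F_{t_{m+1}}$-measurable, $\mathbb E_{t_m}[\Delta\mathcal M^a_m]=0$, $\mathbb E_{t_m}[|\Delta\mathcal M^a_m|^2]<\infty$, $\mathbb E_{t_m}[\Delta\mathcal M^a_mH_m]=0$. *)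

(* Defs.v *)
From HB Require Import structures.
From mathcomp Require Export all_boot all_order all_algebra.
From mathcomp Require Export all_classical all_reals all_analysis.
From mathcomp Require Export measurable_realfun.
Set Implicit Arguments.
Unset Strict Implicit.
Unset Printing Implicit Defensive.
Import Order.TTheory GRing.Theory Num.Theory.
Export numFieldNormedType.Exports.
Local Open Scope classical_set_scope.
Local Open Scope ring_scope.

Section Conditioning.
Context {R : realType} {disp : measure_display} {Omega : measurableType disp}.
Variable P : probability Omega R.
Implicit Types (G : set (set Omega)) (X Y : Omega -> R).

Definition measurable_wrt G X : Prop :=
  forall B : set R, measurable B -> G (X @^-1` B).

Definition measurable_mx_wrt G p q (X : Omega -> 'M[R]_(p, q)) : Prop :=
  forall k l, measurable_wrt G (fun w => X w k l).

Definition is_condexp G X Y : Prop :=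
  [/\ P.-integrable setT (EFin \o X), P.-integrable setT (EFin \o Y),
      measurable_wrt G Y &
      forall A, G A -> (\int[P]_(w in A) (Y w)%:E = \int[P]_(w in A) (X w)%:E)%E].

(* A fixed version of E[X | G]; it is 0 when X has no conditional
   expectation, in particular when X is not integrable. *)
Definition condexp G X : Omega -> R := xget (cst 0) [set Y | is_condexp G X Y].

Definition condexp_mx G p q (X : Omega -> 'M[R]_(p, q)) : Omega -> 'M[R]_(p, q) :=
  fun w => \matrix_(k, l) condexp G (fun w' => X w' k l) w.

Definition is_ess_sup_family (S : set (Omega -> \bar R)) (X : Omega -> \bar R) : Prop :=
  [/\ measurable_fun [set: Omega] X,
      forall Z, S Z -> {ae P, forall w, (Z w <= X w)%E} &
      forall X' : Omega -> \bar R, measurable_fun [set: Omega] X' ->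
        (forall Z, S Z -> {ae P, forall w, (Z w <= X' w)%E}) ->
        {ae P, forall w, (X w <= X' w)%E}].

End Conditioning.

Section Euclidean.
Context {R : realType}.

(* The library norm on matrices is the sup norm; this is the Euclidean one. *)
Definition enorm p q (A : 'M[R]_(p, q)) : R :=
  Num.sqrt (\sum_k \sum_l A k l ^+ 2).

Definition borel_mx p q : set (set 'M[R]_(p, q)) := <<s open >>.

End Euclidean.

Section Brownian.
Context {R : realType} {disp : measure_display} {Omega : measurableType disp}.
Variables (P : probability Omega R) (T : R) (d : nat).
Implicit Types (W : R -> Omega -> 'rV[R]_d) (F : R -> set (set Omega)).

Definition natural_filtration W (t : R) : set (set Omega) :=
  <<s [set A | exists (s : R) (k : 'I_d) (B : set R), [/\ 0 <= s <= t, measurable B &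
                 A = (fun w => W s w 0 k) @^-1` B]] >>.

Definition increment_in W (s t : R) (B : 'I_d -> set R) : set Omega :=
  [set w | forall k, B k (W t w 0 k - W s w 0 k)].

(* The conditions on the increments say that W_t - W_s is independent of
   (W_u)_{u <= s} with law N(0, (t - s) I_d). *)
Definition brownian_motion W : Prop :=
  [/\ forall (t : R) k, 0 <= t <= T -> measurable_fun [set: Omega] (fun w => W t w 0 k),
      {ae P, forall w, W 0 w = 0},
      forall (s t : R) (A : set Omega) (B : 'I_d -> set R),
        0 <= s -> s < t -> t <= T ->
        natural_filtration W s A -> (forall k, measurable (B k)) ->
        (P (A `&` increment_in W s t B)
         = P A * \prod_(k < d) normal_prob 0%R (Num.sqrt (t - s)%R) (B k))%E &
      {ae P, forall w, {within `[0, T], continuous (fun t => W t w)}}].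

Definition augmented_filtration W (t : R) : set (set Omega) :=
  <<s natural_filtration W t `|` [set N | measurable N /\ P N = 0%E] >>.

(* The natural filtration, possibly completed by null sets: both extreme cases
   are allowed. *)
Definition brownian_filtration W F : Prop :=
  [/\ forall t : R, 0 <= t <= T -> sigma_algebra setT (F t),
      forall s t : R, 0 <= s -> s <= t -> t <= T -> F s `<=` F t &
      forall t : R, 0 <= t <= T ->
        natural_filtration W t `<=` F t /\ F t `<=` augmented_filtration W t].

End Brownian.

Section Grids.
Context {R : realType}.

(* 0 = t_0 < ... < t_n = T; the values of t beyond n are irrelevant. *)
Definition grid (T : R) (n : nat) (t : nat -> R) : Prop :=
  [/\ t 0%N = 0, t n = T & forall k, (k < n)%N -> t k < t k.+1].

Definition grid_points (n : nat) (t : nat -> R) : seq R :=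
  [seq t k | k <- iota 0 n.+1].

End Grids.

Record scheme_data (R : realType) (disp : measure_display)
    (Omega : measurableType disp) (d : nat) := SchemeData {
  filt : R -> set (set Omega);
  nsteps : nat;
  tgrid : nat -> R;
  nrefl : nat;
  rgrid : nat -> R;
  scost : R -> Omega -> 'M[R]_d;                    (* C *)
  terminal : Omega -> 'cV[R]_d;                     (* xi *)
  driver : nat -> Omega -> 'M[R]_d -> 'cV[R]_d;     (* F_i *)
  weight : nat -> Omega -> 'rV[R]_d                 (* H_i *)
}.

Record strategy (Omega : Type) (d : nat) := Strategy {
  sw_time : nat -> Omega -> nat;      (* theta_r *)
  regime : nat -> Omega -> 'I_d       (* alpha_r *)
}.

Section Schemes.
Context {R : realType} {disp : measure_display} {Omega : measurableType disp}.
Variables (P : probability Omega R) (d : nat) (D : scheme_data R Omega d).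

Local Notation n := (nsteps D).
Local Notation t := (tgrid D).
Local Notation C := (scost D).
Local Notation xi := (terminal D).
Local Notation F := (driver D).
Local Notation H := (weight D).

Definition step (k : nat) : R := t k.+1 - t k.

Definition refl_time (s : R) : bool := s \in grid_points (nrefl D) (rgrid D).

(* The sigma-algebra at time t_k, equal to the one at T for k > n. *)
Definition filtk (k : nat) : set (set Omega) := filt D (t (minn k n)).

(* max_j (y^j - c^{ij}); the default value of the iterated maximum is the
   term j = i, so that it does not change the maximum. *)
Definition omax (c : 'M[R]_d) (y : 'cV[R]_d) (i : 'I_d) : R :=
  \big[Num.max/y i 0 - c i i]_(j < d) (y j 0 - c i j).

Definition in_Q (c : 'M[R]_d) (y : 'cV[R]_d) : Prop :=
  forall i, omax c y i <= y i 0.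

Definition oproj (c : 'M[R]_d) (y : 'cV[R]_d) : 'cV[R]_d :=
  \col_i omax c y i.

Definition Zstep (k : nat) (Ynext : Omega -> 'cV[R]_d) : Omega -> 'M[R]_d :=
  condexp_mx P (filtk k) (fun w => Ynext w *m H k w).

Definition Ytstep (k : nat) (Ynext : Omega -> 'cV[R]_d) : Omega -> 'cV[R]_d :=
  fun w => condexp_mx P (filtk k) Ynext w
           + step k *: F k w (Zstep k Ynext w).

Definition Ystep (k : nat) (Ynext : Omega -> 'cV[R]_d) : Omega -> 'cV[R]_d :=
  fun w => if refl_time (t k) then oproj (C (t k) w) (Ytstep k Ynext w)
           else Ytstep k Ynext w.

(* Backward recursion: Ystep i (Ystep (i + 1) (... (Ystep (n - 1) xi))). *)
Definition Yrefl (i : nat) : Omega -> 'cV[R]_d :=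
  foldr Ystep xi (iota i (n - i)).

Definition Zrefl (i : nat) : Omega -> 'M[R]_d := Zstep i (Yrefl i.+1).

Definition Ytilde (i : nat) : Omega -> 'cV[R]_d :=
  if (i < n)%N then Ytstep i (Yrefl i.+1) else xi.

Lemma Yrefl_n : Yrefl n = xi.
Proof. by rewrite /Yrefl subnn. Qed.

Lemma Ytilde_n : Ytilde n = xi.
Proof. by rewrite /Ytilde ltnn. Qed.

Lemma ZreflE i : Zrefl i =
  condexp_mx P (filtk i) (fun w => Yrefl i.+1 w *m H i w).
Proof. by []. Qed.

Lemma YtildeE i w : (i < n)%N -> Ytilde i w =
  condexp_mx P (filtk i) (Yrefl i.+1) w + step i *: F i w (Zrefl i w).
Proof. by move=> lin; rewrite /Ytilde lin. Qed.

Lemma YreflE i w : (i < n)%N -> Yrefl i w =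
  if refl_time (t i) then oproj (C (t i) w) (Ytilde i w) else Ytilde i w.
Proof.
by move=> lin; rewrite /Ytilde lin {1}/Yrefl -(subnSK lin) /= -/(Yrefl i.+1).
Qed.

Implicit Type a : strategy Omega d.

(* The last condition is the F_{t_{theta_r}}-measurability of alpha_r. *)
Definition is_strategy a : Prop :=
  [/\ forall r w, (sw_time a r w <= sw_time a r.+1 w)%N,
      forall r k, filtk k [set w | (sw_time a r w <= k)%N] &
      forall r l k, filtk k ([set w | regime a r w = l]
                             `&` [set w | (sw_time a r w <= k)%N])].

(* a_k = alpha_r for theta_r <= k < theta_{r+1}, and a_k = alpha_0 for
   k < theta_0.  The second alternative only concerns the paths with
   infinitely many theta_r <= k, on which a_k is read as the eventual value of
   (alpha_r)_r. *)
Definition state a (k : nat) (w : Omega) : 'I_d :=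
  xget (regime a 0 w)
    [set l | exists r, [/\ regime a r w = l, (sw_time a r w <= k)%N &
       (k < sw_time a r.+1 w)%N \/
       forall s, (r <= s)%N -> (sw_time a s w <= k)%N /\ regime a s w = l]].

(* For k <= n and r >= 1, theta_r <= k already implies r <= N^a. *)
Definition cumcost a (k : nat) (w : Omega) : \bar R :=
  (\sum_(1 <= r <oo | (sw_time a r w <= k)%N)
     (C (t (sw_time a r w)) w (regime a r.-1 w) (regime a r w))%:E)%E.

(* cumcost a k is a.s. finite when a is admissible. *)
Definition cumcostR a (k : nat) (w : Omega) : R := fine (cumcost a k w).

Definition admissible (i : nat) (j : 'I_d) a : Prop :=
  [/\ is_strategy a,
      forall w, sw_time a 0 w = i /\ regime a 0 w = j,
      forall r w, (1 <= r)%N -> (sw_time a r w <= n)%N ->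
        refl_time (t (sw_time a r w)) &
      (\int[P]_w (cumcost a n w ^+ 2) < +oo)%E].

Definition mx_of_row (j : 'I_d) (v : 'rV[R]_d) : 'M[R]_d :=
  \matrix_(k, l) (if k == j then v 0 l else 0).

Definition Vstep a (k : nat) (Unext : Omega -> R) : Omega -> 'rV[R]_d :=
  condexp_mx P (filtk k) (fun w =>
    (Unext w - cumcostR a k.+1 w + cumcostR a k w) *: H k w).

Definition Ustep a (k : nat) (Unext : Omega -> R) : Omega -> R :=
  fun w =>
    condexp P (filtk k)
      (fun w' => Unext w' - cumcostR a k.+1 w' + cumcostR a k w') w
    + step k * F k w (mx_of_row (state a k w) (Vstep a k Unext w)) (state a k w) 0.

Definition Uswitch a (k : nat) : Omega -> R :=
  foldr (Ustep a) (fun w => xi w (state a n w) 0) (iota k (n - k)).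

Definition Vswitch a (k : nat) : Omega -> 'rV[R]_d := Vstep a k (Uswitch a k.+1).

Lemma Uswitch_n a w : Uswitch a n w = xi w (state a n w) 0.
Proof. by rewrite /Uswitch subnn. Qed.

Lemma VswitchE a k : Vswitch a k = condexp_mx P (filtk k) (fun w =>
  (Uswitch a k.+1 w - cumcostR a k.+1 w + cumcostR a k w) *: H k w).
Proof. by []. Qed.

Lemma UswitchE a k w : (k < n)%N -> Uswitch a k w =
  condexp P (filtk k)
    (fun w' => Uswitch a k.+1 w' - cumcostR a k.+1 w' + cumcostR a k w') w
  + step k * F k w (mx_of_row (state a k w) (Vswitch a k w)) (state a k w) 0.
Proof. by move=> lkn; rewrite {1}/Uswitch -(subnSK lkn) /= -/(Uswitch a k.+1). Qed.

Definition switch_value (k : nat) (w : Omega) (l m : 'I_d) : R :=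
  Ytilde k w m 0 - C (t k) w l m.

(* Extended-real maximum: it is -oo when d = 1. *)
Definition best_switch (k : nat) (w : Omega) (l : 'I_d) : \bar R :=
  \big[maxe/-oo%E]_(m < d | m != l) (switch_value k w l m)%:E.

Definition next_time (w : Omega) (th : nat) (l : 'I_d) : nat :=
  \big[minn/n.+1]_(th <= k < n.+1 | refl_time (t k) &&
                     ((Ytilde k w l 0)%:E <= best_switch k w l)%E) k.

(* When th > n there is no switch, and the (irrelevant) regime is left
   unchanged. *)
Definition next_regime (w : Omega) (th : nat) (l : 'I_d) : 'I_d :=
  if (th <= n)%N then
    [arg min_(m < l | (m != l) &&
                      ((switch_value th w l m)%:E == best_switch th w l)) (m : nat)]%N
  else l.

Definition opt_pair (i : nat) (j : 'I_d) (w : Omega) (r : nat) : nat * 'I_d :=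
  iter r (fun p => let th := next_time w p.1 p.2 in (th, next_regime w th p.2))
    (i, j).

Definition opt_strategy (i : nat) (j : 'I_d) : strategy Omega d :=
  Strategy (fun r w => (opt_pair i j w r).1) (fun r w => (opt_pair i j w r).2).

End Schemes.

Section Assumptions.
Context {R : realType} {disp : measure_display} {Omega : measurableType disp}.
Variables (P : probability Omega R) (T : R) (d : nat) (D : scheme_data R Omega d).

Local Notation n := (nsteps D).
Local Notation t := (tgrid D).
Local Notation C := (scost D).
Local Notation xi := (terminal D).
Local Notation F := (driver D).
Local Notation H := (weight D).

Definition grids_ok : Prop :=
  [/\ grid T n t, grid T (nrefl D) (rgrid D) &
      {subset grid_points (nrefl D) (rgrid D) <= grid_points n t}].

Definition cadlag (f : R -> R) : Prop :=
  (forall s : R, 0 <= s < T -> f x @[x --> s^'+] --> f s) /\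
  (forall s : R, 0 < s <= T -> cvg (f x @[x --> s^'-])).

Definition cost_process : Prop :=
  (forall s : R, 0 <= s <= T -> measurable_mx_wrt (filt D s) (C s)) /\
  {ae P, forall w, forall k l, cadlag (fun s => C s w k l)}.

Definition terminal_ok : Prop :=
  [/\ measurable_mx_wrt (filt D T) xi,
      (\int[P]_w (enorm (xi w) ^+ 2)%:E < +oo)%E &
      {ae P, forall w, in_Q (C T w) (xi w)}].

Definition independent_weights : Prop :=
  forall B : nat -> set 'rV[R]_d,
    (forall k, (k < n)%N -> borel_mx (B k)) ->
    (P [set w | forall k, (k < n)%N -> B k (H k w)]
     = \prod_(k < n) P (H k @^-1` B k))%E.

Definition weights_ok (lambda Lambda : R) (lam : nat -> R) : Prop :=
  [/\ independent_weights,
      forall k, (k < n)%N -> measurable_mx_wrt (filt D (t k.+1)) (H k),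
      forall k l, (k < n)%N ->
        is_condexp P (filt D (t k)) (fun w => H k w 0 l) (cst 0),
      forall k l m, (k < n)%N ->
        ((step D k)%:E * \int[P]_w ((((H k w)^T *m H k w) l m)%:E)
           = ((lam k)%:M l m : R)%:E)%E /\
        is_condexp P (filt D (t k))
          (fun w => step D k * ((H k w)^T *m H k w) l m)
          (cst ((lam k)%:M l m)) &
      [/\ 0 < lambda, 0 < Lambda &
          forall k, (k < n)%N -> lambda / d%:R <= lam k <= Lambda / d%:R]].

Definition driver_measurable : Prop :=
  forall k l (B : set R), (k < n)%N -> measurable B ->
    (<<s [set E | exists A M, [/\ filt D (t k) A, borel_mx M & E = A `*` M]] >>
       : set (set (Omega * 'M[R]_d))) [set p | B (F k p.1 p.2 l 0)].

Definition cost_structure (eps : R) : Prop :=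
  0 < eps /\
  {ae P, forall w,
    [/\ forall k (s : R), 0 <= s <= T -> C s w k k = 0,
        forall k l : 'I_d, k != l ->
          (eps%:E <= ereal_inf [set (C s w k l)%:E | s in `[0%R, T]])%E &
        forall k l m : 'I_d, k != l -> l != m ->
          (0 < ereal_inf [set (C s w k l + C s w l m - C s w k m)%:E
                         | s in `[0%R, T]])%E]}.

Definition driver_diagonal : Prop :=
  forall k, (k < n)%N ->
    {ae P, forall w, forall l (z z' : 'M[R]_d),
       row l z = row l z' -> F k w z l 0 = F k w z' l 0}.

Definition driver_lipschitz (LZ : R) : Prop :=
  forall k, (k < n)%N ->
    {ae P, forall w, forall z z' : 'M[R]_d,
       enorm (F k w z - F k w z') <= LZ * enorm (z - z')}.

(* The moment condition with p = 2. *)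
Definition moment_bound (Cp : R) : Prop :=
  (\int[P]_w (enorm (xi w) ^+ 2
     + \sum_(k < n) enorm (F k w 0) ^+ 2 * step D k
     + \big[Num.max/0]_(k < n.+1 | refl_time D (t k))
         enorm (C (t k) w) ^+ 2)%:E <= Cp%:E)%E.

Definition weights_bounded (LZ : R) : Prop :=
  forall k, (k < n)%N -> {ae P, forall w, step D k * enorm (H k w) * LZ <= 1}.

End Assumptions.

(* Main.v *)
From HB Require Import structures.
Require Import Defs.
From mathcomp Require Import ring lra zify.
Set Implicit Arguments.
Unset Strict Implicit.
Unset Printing Implicit Defensive.
Import Order.TTheory GRing.Theory Num.Theory.
Local Open Scope classical_set_scope.
Local Open Scope ring_scope.

(** Write A for the cumulative cost of a strategy a, U for its switched value,
    a_k for its state at t_k, and Yt, Y for the reflected scheme before and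
    after projection.

    Everything rests on a comparison for a single backward step
    ([one_step_comparison]): the map
    X |-> E_k[X] + h F^l(E_k[X H]) is monotone.  Indeed, for X <= X' the driver
    can lower the result by at most h L |E_k[(X' - X) H]|, and this is at most
    E_k[X' - X] because h L |H| <= 1 ([weighted_condexp_le]).  The comparison
    holds on any event of the sigma-algebra of the step, in particular on each
    event {a_k = l}, where the step of U and the step of the l-th component of
    Yt use the same driver.  The same bound shows that all the variables of
    both schemes are integrable, so that the whole argument takes place in L1.

    Backward induction then gives U_k <= Yt_k^{a_k} ([switched_le]), provided
    that U_{k+1} minus the cost paid at t_{k+1} is at most Y_{k+1}^{a_k}.  This
    is where the cost structure enters: several switches at the same time cost
    at least as much as the direct one, by the triangle inequality
    ([run_cost_ge]), and Yt^m - C^{lm} <= Y^l at a reflection time.  Since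
    genuine switches cost at least eps, a finite total cost allows almost
    surely only finitely many of them ([finite_switches]), so that the state
    and the cost of a strategy are computed by a finite recursion along almost
    every path.

    Along the paths of the greedy strategy all these inequalities are
    equalities ([opt_run_step]).  The strict triangle inequality forbids two
    switches at the same time ([opt_time_lt]), so there are at most n + 2
    switches; the cost is therefore at most n + 2 times the largest
    |C_{t_k}|, which is square integrable, and the greedy strategy is
    admissible.  Its value is the essential supremum because it is attained.

    The scheme uses chosen versions of conditional expectations, so their
    existence has to be established ([condexp_exists]). *)

(** * Conditional expectations *)

Section MonotoneIntegral.
Context {d : measure_display} {T : measurableType d} {R : realType}.
Variable mu : {measure set T -> \bar R}.
Import HBNNSimple.
Local Open Scope ereal_scope.

(** Neither function has to be measurable: the integral is a supremum over
    simple functions below the integrand, and setting such a function to zero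
    on a null set does not change its integral. *)
Lemma ge0_le_integral_ae (f g : T -> \bar R) :
  (forall x, 0 <= f x) -> (forall x, 0 <= g x) ->
  {ae mu, forall x, f x <= g x} ->
  \int[mu]_x f x <= \int[mu]_x g x.
Proof.
move=> f0 g0 [N [mN muN fgN]].
rewrite !ge0_integralTE//; apply: ge_ereal_sup => /= _ [h hf <-].
pose h1 := mul_nnsfun h (indic_nnsfun R (measurableC mN)).
have -> : sintegral mu h = sintegral mu h1.
  rewrite -!integralT_nnsfun; apply: ae_eq_integral => //=.
  - by apply/measurable_EFinP; exact: measurable_funP.
  - by apply/measurable_EFinP; apply: measurable_funM; exact: measurable_funP.
  exists N; split => // x /=; apply: contra_notP => Nx _.
  by rewrite mindicE mem_set// mulr1.
apply: ereal_sup_ubound; exists h1 => //= x.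
have [Nx|Nx] := pselect (N x).
  by rewrite /= mindicE memNset ?mulr0//= => /(_ Nx).
rewrite /= mindicE mem_set// mulr1; apply: (le_trans (hf x)).
by apply: contrapT => nfg; apply: Nx; exact: fgN.
Qed.

End MonotoneIntegral.

Section Integrable.
Context {R : realType} {disp : measure_display} {Omega : measurableType disp}.
Variable P : probability Omega R.
Implicit Types X Y : Omega -> R.

Definition L1 X := P.-integrable setT (EFin \o X).

Lemma L1_meas X : L1 X -> measurable_fun setT X.
Proof. by move=> /measurable_int /measurable_EFinP. Qed.

Lemma L1_ext X Y : X =1 Y -> L1 X -> L1 Y.
Proof. by move=> /funext ->. Qed.

Lemma L1_cst (c : R) : L1 (cst c).
Proof. exact: finite_measure_integrable_cst. Qed.

Lemma L1D X Y : L1 X -> L1 Y -> L1 (fun w => X w + Y w).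
Proof. move=> hX hY; have := integrableD measurableT hX hY; exact. Qed.

Lemma L1Z (c : R) X : L1 X -> L1 (fun w => c * X w).
Proof. move=> hX; have := integrableZl measurableT c hX; exact. Qed.

Lemma L1N X : L1 X -> L1 (fun w => - X w).
Proof. move=> /(L1Z (-1)); apply: L1_ext => w; ring. Qed.

Lemma L1B X Y : L1 X -> L1 Y -> L1 (fun w => X w - Y w).
Proof. by move=> hX hY; apply: L1D => //; apply: L1N. Qed.

Lemma L1_sum (I : Type) (s : seq I) (Q : pred I) (X : I -> Omega -> R) :
  (forall i, Q i -> L1 (X i)) -> L1 (fun w => \sum_(i <- s | Q i) X i w).
Proof.
move=> hX; elim: s => [|i s IH].
  by under eq_fun do rewrite big_nil; exact: L1_cst.
under eq_fun do rewrite big_cons.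
by case: (boolP (Q i)) => // Qi; apply: L1D => //; exact: hX.
Qed.

Lemma L1_abs X : L1 X -> L1 (fun w => `|X w|).
Proof. by move=> hX; have := integrable_norm hX. Qed.

Lemma L1_dom X Y : measurable_fun setT X -> L1 Y ->
  {ae P, forall w, `|X w| <= Y w} -> L1 X.
Proof.
move=> mX hY XY; apply/integrableP; split; first exact/measurable_EFinP.
have [_ ] := integrableP _ _ _ (L1_abs hY); apply: le_lt_trans.
apply: ge0_le_integral_ae => //.
apply: filterS XY => w /= h; rewrite lee_fin normr_id.
by rewrite (le_trans h)// ler_norm.
Qed.

Lemma L1_indic (A : set Omega) X : measurable A -> L1 X ->
  L1 (fun w => X w * \1_A w).
Proof.
move=> mA hX; apply: (L1_dom _ (L1_abs hX)).
  by apply: measurable_funM => //; exact: L1_meas.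
apply: nearW => w; rewrite indicE; case: (w \in A) => /=.
  by rewrite mulr1.
by rewrite mulr0 normr0.
Qed.

(** Since |x| <= 1 + x^2 and P is finite. *)
Lemma L1_of_sqr X : measurable_fun setT X ->
  (\int[P]_w (X w ^+ 2)%:E < +oo)%E -> L1 X.
Proof.
move=> mX hX.
have m2 : measurable_fun setT (fun w => X w ^+ 2) by exact: measurable_funX.
have h2 : L1 (fun w => X w ^+ 2).
  apply/integrableP; split; first exact/measurable_EFinP.
  apply: le_lt_trans hX; apply: ge0_le_integral_ae => //.
    by move=> w; rewrite lee_fin sqr_ge0.
  by apply: nearW => w /=; rewrite lee_fin ger0_norm// sqr_ge0.
apply: (L1_dom mX (L1D (L1_cst 1) h2)).
apply: nearW => w /=; rewrite ler_norml; apply/andP; split; nra.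
Qed.

End Integrable.

Section ConditionalExpectation.
Context {R : realType} {disp : measure_display} {Omega : measurableType disp}.
Variable P : probability Omega R.
Variable G : set (set Omega).
Hypothesis sG : sigma_algebra setT G.
Hypothesis mG : G `<=` measurable.
Implicit Types X Y : Omega -> R.

Lemma sgE : (@measurable _ (g_sigma_algebraType G)) = G.
Proof. exact: sigma_algebra_id. Qed.

Lemma measurable_wrtP X : measurable_wrt G X <->
  measurable_fun setT (X : g_sigma_algebraType G -> R).
Proof.
split=> [h _ B mB|h B mB].
  by rewrite setTI [X in X _]sgE; exact: h.
by have := h measurableT B mB; rewrite setTI [X in X _ -> _]sgE.
Qed.

Lemma measurable_wrt_fun X : measurable_wrt G X -> measurable_fun setT X.
Proof. by move=> h _ B mB; rewrite setTI; apply: mG; exact: h. Qed.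

Lemma id_meas : measurable_fun setT (id : Omega -> g_sigma_algebraType G).
Proof.
by move=> _ A; rewrite [X in X _ -> _]sgE setTI preimage_id => /mG.
Qed.

Let id_mixin := isMeasurableFun.Build _ _ _ _ _ id_meas.
Let idG : {mfun Omega >-> g_sigma_algebraType G} := HB.pack (id : Omega -> g_sigma_algebraType G) id_mixin.

(** E[X | G] is the Radon-Nikodym derivative of A |-> E[X 1_A] with respect
    to P, both restricted to G.  The restriction is the image under the
    identity map into Omega equipped with the smaller sigma-algebra. *)
Lemma condexp_exists X : L1 P X -> exists Y, is_condexp P G X Y.
Proof.
move=> hX.
pose nu := pushforward (induced_charge hX) idG.
(* the charge structure of a pushforward takes the measurability of the map
   as a further argument *)
pose nuF : {charge set (g_sigma_algebraType G) -> \bar R} := nu.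
pose nuC : {charge set (g_sigma_algebraType G) -> \bar R} := nuF id_meas.
pose mu := distribution P idG.
have numu : nuC `<< mu.
  apply: dominates_pushforward => //.
  apply/null_content_dominatesP => A mA PA.
  by apply: null_set_integral => //; exact: measurable_funTS (measurable_int _ hX).
have [f [ffin fint fE]] : exists f : g_sigma_algebraType G -> \bar R, [/\ (forall x, f x \is a fin_num),
    mu.-integrable [set: _] f &
    forall A, measurable A -> nuC A = \int[mu]_(x in A) f x]%E.
  exists (Radon_Nikodym nuC mu); split.
  - by move=> x; exact: Radon_Nikodym_fin_num.
  - exact: Radon_Nikodym_integrable.
  - by move=> A mA; exact: Radon_Nikodym_integral.
have mf := measurable_int _ fint.
have mfO : measurable_fun setT (f : Omega -> \bar R).
  exact: (measurableT_comp mf id_meas).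
exists (fine \o f : Omega -> R).
have fEq : EFin \o (fine \o f) = f by apply/funext => x /=; rewrite fineK.
have fO : P.-integrable setT (f : Omega -> \bar R).
  apply/integrableP; split => //.
  have [_] := integrableP _ _ _ fint.
  rewrite ge0_integral_distribution//.
  exact: measurableT_comp.
split => //.
- by rewrite fEq.
- apply/measurable_wrtP.
  exact: measurableT_comp mf.
- move=> A GA.
  have mA : @measurable _ (g_sigma_algebraType G) A by rewrite [X in X _]sgE.
  have mA' := mG GA.
  under eq_integral do rewrite -[(fine \o f) _]/(fine (f _)) fineK//.
  have := fE A mA.
  rewrite integral_pushforward//; last exact: integrableS fO.
Qed.


Lemma condexpP X : L1 P X -> is_condexp P G X (condexp P G X).
Proof.
move=> /condexp_exists[Y hY].
by have := @xgetPex _ (cst 0) [set Y | is_condexp P G X Y] (ex_intro _ Y hY).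
Qed.

Lemma condexp_measurable X : measurable_wrt G (condexp P G X).
Proof.
rewrite /condexp; case: xgetP => [Y -> []//|_].
by apply/measurable_wrtP; exact: measurable_cst.
Qed.

Lemma condexp_L1 X : L1 P (condexp P G X).
Proof. by rewrite /condexp; case: xgetP => [Y -> []//|_]; exact: L1_cst. Qed.

Lemma is_condexpD (a : R) X X' Y Y' :
  is_condexp P G X Y -> is_condexp P G X' Y' ->
  is_condexp P G (fun w => a * X w + X' w) (fun w => a * Y w + Y' w).
Proof.
move=> [iX iY mY XY] [iX' iY' mY' XY']; split.
- by apply: (L1D _ iX'); apply: L1Z.
- by apply: (L1D _ iY'); apply: L1Z.
- apply/measurable_wrtP.
  move: mY mY' => /measurable_wrtP mY /measurable_wrtP mY'.
  by apply: measurable_funD => //; apply: measurable_funM.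
- move=> A GA; have mA := mG GA.
  have iS f : P.-integrable setT (EFin \o f) -> P.-integrable A (EFin \o f).
    by move=> h; exact: (integrableS measurableT _ _ h).
  have E (Z Z' : Omega -> R) : P.-integrable setT (EFin \o Z) ->
      P.-integrable setT (EFin \o Z') ->
      (\int[P]_(w in A) (a * Z w + Z' w)%:E =
       a%:E * \int[P]_(w in A) (Z w)%:E + \int[P]_(w in A) (Z' w)%:E)%E.
    move=> iZ iZ'; rewrite -integralZl//; last exact: iS.
    rewrite -integralD//; last exact: iS.
    exact: (integrableZl mA a (iS _ iZ)).
  by rewrite !E// XY// XY'.
Qed.

Lemma is_condexp_sum (I : Type) (s : seq I) (a : I -> R) (X Y : I -> Omega -> R) :
  (forall i, is_condexp P G (X i) (Y i)) ->
  is_condexp P G (fun w => \sum_(i <- s) a i * X i w)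
                 (fun w => \sum_(i <- s) a i * Y i w).
Proof.
move=> h; elim: s => [|i s IH].
  rewrite (_ : (fun _ => _) = cst 0); last by apply/funext => w; rewrite big_nil.
  rewrite [X in is_condexp _ _ _ X](_ : _ = cst 0); last first.
    by apply/funext => w; rewrite big_nil.
  split=> //; [exact: L1_cst|exact: L1_cst|].
  by apply/measurable_wrtP; exact: measurable_cst.
under eq_fun do rewrite big_cons.
under [X in is_condexp _ _ _ X]eq_fun do rewrite big_cons.
exact: is_condexpD.
Qed.

(** The conditional expectation cannot be negative on a non-null part of
    A: the event A /\ {Y < 0} is in G, hence X has a negative integral
    there. *)
Lemma is_condexp_ge0 X Y (A : set Omega) : is_condexp P G X Y -> G A ->
  {ae P, forall w, A w -> 0 <= X w} -> {ae P, forall w, A w -> 0 <= Y w}.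
Proof.
move=> [iX iY mY XY] GA X0.
have mYO : measurable_fun setT Y := L1_meas iY.
pose B := A `&` Y @^-1` `]-oo, 0[.
have GB : G B.
  have : @measurable _ (g_sigma_algebraType G) B.
    apply: measurableI; rewrite [X in X _]sgE//.
    by apply: mY; exact: measurable_itv.
  by rewrite [X in X _ -> _]sgE.
have mB := mG GB.
have BN w : B w -> Y w < 0 by case => _ /=; rewrite in_itv.
have mYB : measurable_fun B (EFin \o Y).
  by apply/measurable_EFinP; exact: measurable_funTS.
have XE : (0 <= \int[P]_(w in B) (X w)%:E)%E.
  rewrite (ae_eq_integral (fun w => `|X w|%:E))//.
  - by apply: integral_ge0 => w _; rewrite lee_fin.
  - by apply: measurableT_comp => //; apply: measurable_funTS; exact: L1_meas iX.
  - apply: measurableT_comp => //; apply: measurable_funTS.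
    by apply: measurableT_comp => //; exact: L1_meas iX.
  - by apply: filterS X0 => w h [Aw _]; rewrite ger0_norm//; exact: h.
have Y0 : (\int[P]_(w in B) `|(Y w)%:E| = 0)%E.
  apply/eqP; rewrite eq_le integral_ge0// andbT.
  rewrite -oppe_ge0 -integral_ge0N//.
  rewrite (eq_integral (fun w => (Y w)%:E)) ?XY// => w; rewrite inE => /BN Yw.
  by rewrite abse_EFin ltr0_norm// -EFinN opprK.
have : ae_eq P B (EFin \o Y) (cst 0%E).
  by apply/ae_eq_integral_abs.
apply: filterS => w h Aw; rewrite leNgt; apply/negP => Yw.
have Bw : B w by split => //=; rewrite in_itv.
by move: (BN _ Bw); have := h Bw; case=> ->; rewrite ltxx.
Qed.

End ConditionalExpectation.

(** * Measurability *)

(** The limit of a divergent sequence is a fixed point, so the limit is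
    measurable on all of the space: it is the limit superior where it agrees
    with the limit inferior, and constant elsewhere.  Cumulative costs are
    such limits, and may diverge on a null set. *)
Lemma measurable_fun_limn {d : measure_display} {T : measurableType d} {R : realType}
    (u : nat -> T -> \bar R) : (forall n, measurable_fun setT (u n)) ->
  measurable_fun setT (fun w => limn (u ^~ w)).
Proof.
move=> mu.
have msup := @measurable_fun_limn_esup _ _ _ setT _ mu.
have minf : measurable_fun setT (fun w => limn_einf (u ^~ w)).
  have mN n : measurable_fun setT (fun w => - u n w)%E.
    exact: measurableT_comp (mu n).
  have := @measurable_fun_limn_esup _ _ _ setT _ mN.
  move=> /(measurableT_comp (@oppe_measurable R setT)); apply: eq_measurable_fun => w _.
  by rewrite /= (@limn_esupN _ (u ^~ w)) oppeK.
pose E := [set w | limn_esup (u ^~ w) = limn_einf (u ^~ w)].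
have mE : measurable E.
  by have := measurable_eqe measurableT msup minf; rewrite setTI.
rewrite (_ : (fun _ => _) =
   (fun w => if w \in E then limn_esup (u ^~ w) else point)).
  apply: measurable_fun_if => //.
  - by apply: (measurable_fun_bool true); rewrite setTI preimage_mem_true.
  - exact: measurable_funTS.
apply/funext => w; case: ifPn => [|].
  rewrite inE /E/= => eE; rewrite is_cvg_limn_esupE//.
  have i1 := @is_cvg_esups _ (u ^~ w); have i2 := @is_cvg_einfs _ (u ^~ w).
  apply/cvg_ex; exists (limn_esup (u ^~ w)).
  apply: (@squeeze_cvge _ _ _ _ (einfs (u ^~ w)) (u ^~ w) (esups (u ^~ w))).
  - apply: nearW => n; apply/andP; split.
      by apply: ereal_inf_lbound; exists n => /=.
    by apply: ereal_sup_ubound; exists n => /=.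
  - by rewrite eE limn_einf_lim.
  - by rewrite limn_esup_lim.
move=> /negP nE; apply: dvgP => cu; apply: nE; rewrite inE /E/=.
by rewrite is_cvg_limn_esupE// is_cvg_limn_einfE.
Qed.

Lemma preimage_g_sigma (T U : Type) (f : T -> U) (G : set (set T))
    (E : set (set U)) : sigma_algebra setT G ->
  (forall A, E A -> G (f @^-1` A)) -> forall A, <<s E >> A -> G (f @^-1` A).
Proof.
move=> sG EG A hA.
suff : image_set_system setT f G A by rewrite /image_set_system /= setTI.
apply: (smallest_sub _ _ hA).
  exact: sigma_algebra_image.
by move=> B EB; rewrite /image_set_system /= setTI; exact: EG.
Qed.

Section MatrixMeasurability.
Context {R : realType} {disp : measure_display} {Omega : measurableType disp}.
Variable G : set (set Omega).
Hypothesis sG : sigma_algebra setT G.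

(** An open set of matrices is a countable union of boxes with rational
    centres, and the preimage of a box is a finite intersection of preimages
    of intervals under the entries. *)
Lemma borel_mx_preimage p q (M : Omega -> 'M[R]_(p, q)) :
  measurable_mx_wrt G M -> forall S, borel_mx S -> G (M @^-1` S).
Proof.
move=> mM; apply: preimage_g_sigma => // U oU.
pose box (b : 'M[rat]_(p, q) * nat) : set 'M[R]_(p, q) :=
  ball (map_mx ratr b.1 : 'M[R]_(p, q)) b.2.+1%:R^-1.
have -> : M @^-1` U = \bigcup_b (if asbool (box b `<=` U) then M @^-1` box b else set0).
  apply/seteqP; split => [w /= Uw|w [b _]]; last first.
    by case: asboolP => // bU Mw; exact: bU.
  have [e /= e0 eU] := (nbhs_ballP _ _).1 (open_nbhs_nbhs (conj oU Uw)).
  have [m mP] : exists m : nat, m.+1%:R^-1 < e / 2.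
    exists (Num.truncn (e / 2)^-1); rewrite invf_plt ?posrE ?divr_gt0//.
    exact: truncnS_gt.
  have m0 : 0 < m.+1%:R^-1 :> R by rewrite invr_gt0.
  have [Q QP] : exists Q : 'M[rat]_(p, q), forall i j, `|M w i j - ratr (Q i j)| < m.+1%:R^-1.
    have h (i : 'I_p) (j : 'I_q) : exists r : rat, `|M w i j - ratr r| < m.+1%:R^-1.
      have /rat_in_itvoo[r] : M w i j - m.+1%:R^-1 < M w i j + m.+1%:R^-1.
        by rewrite ltrBlDr -addrA ltrDl addr_gt0.
      rewrite in_itv /= => /andP[h1 h2]; exists r.
      by rewrite ltr_distlC h1 h2.
    pose r i j := projT1 (cid (h i j)).
    exists (\matrix_(i, j) r i j) => i j; rewrite mxE.
    exact: (projT2 (cid (h i j))).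
  exists (Q, m) => //; case: asboolP => [_|].
    by split => // i j; rewrite !mxE /ball/= distrC; exact: QP.
  case=> Z [_ hZ]; apply: eU; split => // i j.
  have := hZ i j; rewrite /ball/= mxE => {}hZ.
  have -> : M w i j - Z i j = (M w i j - ratr (Q i j)) + (ratr (Q i j) - Z i j) by ring.
  rewrite (le_lt_trans (ler_normD _ _))//.
  by rewrite (splitr e) ltrD // (lt_trans _ mP) // QP.
have sgG := @sgE _ _ _ sG; rewrite -[X in X _]sgG.
apply: countable_bigcupT_measurable => [|b]; [exact: countableP|case: asboolP => // _].
rewrite (_ : _ @^-1` _ = \bigcap_(i in [set: 'I_p]) \bigcap_(j in [set: 'I_q])
   (fun w => M w i j) @^-1` ball (ratr (b.1 i j) : R) b.2.+1%:R^-1).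
  apply: fin_bigcap_measurable => // i _; apply: fin_bigcap_measurable => // j _.
  rewrite [X in X _]sgG; apply: mM.
  by apply: measurable_ball.
apply/seteqP; split => [w [_ h] i _ j _|w h].
  by have := h i j; rewrite mxE.
split; first by rewrite invr_gt0.
by move=> i j; rewrite mxE; exact: h.
Qed.

(** A jointly measurable function of the outcome and a matrix, evaluated at
    a G-measurable random matrix, is G-measurable: it is its composition with
    w |-> (w, M w). *)
Lemma measurable_mx_comp p q p' q' (f : Omega -> 'M[R]_(p, q) -> 'M[R]_(p', q'))
    (M : Omega -> 'M[R]_(p, q)) :
  (forall k l (B : set R), measurable B ->
    (<<s [set E | exists A S, [/\ G A, borel_mx S & E = A `*` S]] >>
       : set (set (Omega * 'M[R]_(p, q)))) [set x | B (f x.1 x.2 k l)]) ->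
  measurable_mx_wrt G M -> measurable_mx_wrt G (fun w => f w (M w)).
Proof.
move=> mf mM k l B mB.
have := preimage_g_sigma (f := fun w => (w, M w)) sG _ (mf k l B mB).
apply => _ [A [S [GA bS ->]]].
rewrite (_ : _ @^-1` _ = A `&` M @^-1` S)//.
rewrite -[X in X _](@sgE _ _ _ sG); apply: measurableI; rewrite [X in X _]sgE//.
exact: borel_mx_preimage.
Qed.

End MatrixMeasurability.

Section SigmaAlgebraSets.
Context {R : realType} {disp : measure_display} {Omega : measurableType disp}.
Variable G : set (set Omega).
Hypothesis sG : sigma_algebra setT G.
Implicit Types A B : set Omega.

Local Notation GE := (sgE sG).

Lemma G_setT : G setT.
Proof.
by have := @measurableT _ (g_sigma_algebraType G); rewrite [X in X _](sgE sG).
Qed.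

Lemma G_setC A : G A -> G (~` A).
Proof. by rewrite -[X in X _ -> _]GE -[X in _ -> X _]GE; exact: measurableC. Qed.

Lemma G_setI A B : G A -> G B -> G (A `&` B).
Proof.
rewrite -[X in X _ -> _]GE -[X in _ -> X _ -> _]GE -[X in _ -> _ -> X _]GE.
exact: measurableI.
Qed.

Lemma G_const (Q : Prop) : G [set _ | Q].
Proof.
have [q|q] := pselect Q.
  by rewrite (_ : [set _ | _] = setT); [exact: G_setT|apply/seteqP; split].
rewrite (_ : [set _ | _] = ~` setT); first by apply: G_setC; exact: G_setT.
by rewrite setCT; apply/seteqP; split.
Qed.

Lemma G_exists (I : countType) (A : I -> set Omega) :
  (forall i, G (A i)) -> G [set w | exists i, A i w].
Proof.
move=> GA; rewrite (_ : [set w | _] = \bigcup_i A i); last first.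
  by apply/seteqP; split => [w [i Ai]|w [i _ Ai]]; exists i.
rewrite -[X in X _]GE; apply: countable_bigcupT_measurable => [|i].
  exact: countableP.
by rewrite [X in X _]GE.
Qed.

Lemma G_forall (I : countType) (A : I -> set Omega) :
  (forall i, G (A i)) -> G [set w | forall i, A i w].
Proof.
move=> GA; rewrite (_ : [set w | _] = ~` [set w | exists i, (~` A i) w]).
  by apply: G_setC; apply: G_exists => i; exact: G_setC.
apply/seteqP; split => [w /= h [i]|w /= h i]; first exact.
by apply: contrapT => nA; apply: h; exists i.
Qed.

(** A property of a random variable with finitely many values is an event
    as soon as each value is taken on an event. *)
Lemma G_finite (I : finType) (h : Omega -> I) (Q : I -> Prop) :
  (forall i, G [set w | h w = i]) -> G [set w | Q (h w)].
Proof.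
move=> Gh; rewrite (_ : [set w | _] = [set w | exists i, ([set w | h w = i] `&` [set _ | Q i]) w]).
  by apply: G_exists => i; apply: G_setI => //; exact: G_const.
by apply/seteqP; split => [w /= q|w /= [i [<-]]//]; exists (h w).
Qed.

Lemma G_ler (f g : Omega -> R) : measurable_wrt G f -> measurable_wrt G g ->
  G [set w | f w <= g w].
Proof.
move=> /(measurable_wrtP sG) mf /(measurable_wrtP sG) mg.
have := measurable_lee measurableT (measurableT_comp (@EFin_measurable R _) mf)
   (measurableT_comp (@EFin_measurable R _) mg).
by rewrite setTI [X in X _ -> _]GE; congr (G _); apply/seteqP; split => w /=; rewrite lee_fin.
Qed.

Lemma measurable_wrt_bigmax (I : Type) (s : seq I) (f0 : Omega -> R) (f : I -> Omega -> R) :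
  measurable_wrt G f0 -> (forall i, measurable_wrt G (f i)) ->
  measurable_wrt G (fun w => \big[Num.max/f0 w]_(i <- s) f i w).
Proof.
move=> mf0 mf; elim: s => [|i s IH].
  by under eq_fun do rewrite big_nil.
under eq_fun do rewrite big_cons.
apply/(measurable_wrtP sG); apply: measurable_maxr; apply/(measurable_wrtP sG) => //.
Qed.

Lemma measurable_wrtD (f g : Omega -> R) : measurable_wrt G f -> measurable_wrt G g ->
  measurable_wrt G (fun w => f w + g w).
Proof.
move=> /(measurable_wrtP sG) mf /(measurable_wrtP sG) mg.
by apply/(measurable_wrtP sG); exact: measurable_funD.
Qed.

Lemma measurable_wrtB (f g : Omega -> R) : measurable_wrt G f -> measurable_wrt G g ->
  measurable_wrt G (fun w => f w - g w).
Proof.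
move=> /(measurable_wrtP sG) mf /(measurable_wrtP sG) mg.
by apply/(measurable_wrtP sG); exact: measurable_funB.
Qed.

Lemma measurable_wrtZ (c : R) (f : Omega -> R) : measurable_wrt G f ->
  measurable_wrt G (fun w => c * f w).
Proof.
move=> /(measurable_wrtP sG) mf.
by apply/(measurable_wrtP sG); exact: measurable_funM.
Qed.

End SigmaAlgebraSets.

(** * The Euclidean norm *)

Lemma ae_forall_count {R : realType} {d : measure_display} {T : measurableType d}
    (mu : {measure set T -> \bar R}) (I : countType) (Q : I -> T -> Prop) :
  (forall i, {ae mu, forall x, Q i x}) -> {ae mu, forall x, forall i, Q i x}.
Proof.
move=> h.
have : {ae mu, forall x, forall n : nat, if unpickle n is Some i then Q i x else True}.
  apply: ae_foralln => n; case: unpickle => [i|]; first exact: h.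
  exact: nearW.
by apply: filterS => x hx i; have := hx (pickle i); rewrite pickleK.
Qed.

Section EuclideanNorm.
Context {R : realType}.

Lemma enorm_ge0 p q (A : 'M[R]_(p, q)) : 0 <= enorm A.
Proof. exact: sqrtr_ge0. Qed.

Lemma enorm_sqr p q (A : 'M[R]_(p, q)) : enorm A ^+ 2 = \sum_k \sum_l A k l ^+ 2.
Proof.
by rewrite sqr_sqrtr//; apply: sumr_ge0 => k _; apply: sumr_ge0 => l _; rewrite sqr_ge0.
Qed.

Lemma enorm_sqr_row q (v : 'rV[R]_q) : enorm v ^+ 2 = \sum_l v 0 l ^+ 2.
Proof. by rewrite enorm_sqr big_ord1. Qed.

Lemma ler_enorm p q (A : 'M[R]_(p, q)) k l : `|A k l| <= enorm A.
Proof.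
rewrite -(@ler_pXn2r _ 2) ?nnegrE ?enorm_ge0// enorm_sqr real_normK ?num_real//.
rewrite (bigD1 k)//= (bigD1 l)//= -addrA lerDl addr_ge0//.
  by apply: sumr_ge0 => *; exact: sqr_ge0.
by apply: sumr_ge0 => *; apply: sumr_ge0 => *; exact: sqr_ge0.
Qed.

Lemma enorm_le_sum q (v : 'rV[R]_q) : enorm v <= \sum_l `|v 0 l|.
Proof.
have s0 (P : pred 'I_q) : 0 <= \sum_(l | P l) `|v 0 l| by apply: sumr_ge0.
rewrite -(@ler_pXn2r _ 2) ?nnegrE ?enorm_ge0// enorm_sqr_row.
rewrite expr2 mulr_suml; apply: ler_sum => l _.
rewrite -(real_normK (num_real _)) expr2 ler_wpM2l// (bigD1 l)//=.
by rewrite lerDl.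
Qed.

Lemma cauchy_schwarz q (u v : 'rV[R]_q) :
  \sum_l u 0 l * v 0 l <= enorm u * enorm v.
Proof.
set a := enorm u; set b := enorm v; set s := \sum_l _.
have a0 : 0 <= a by exact: enorm_ge0.
have b0 : 0 <= b by exact: enorm_ge0.
have [ab0|ab0] := eqVneq (a * b) 0.
  rewrite ab0 /s big1// => l _; apply/eqP; rewrite -normr_eq0 normrM.
  rewrite eq_le mulr_ge0// andbT -ab0.
  by apply: ler_pM => //; exact: ler_enorm.
have ab : 0 < a * b by rewrite lt_neqAle eq_sym ab0 mulr_ge0.
have : 0 <= \sum_l (b * u 0 l - a * v 0 l) ^+ 2.
  by apply: sumr_ge0 => l _; exact: sqr_ge0.
have -> : \sum_l (b * u 0 l - a * v 0 l) ^+ 2 =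
    b ^+ 2 * \sum_l u 0 l ^+ 2 - 2 * (a * b) * s + a ^+ 2 * \sum_l v 0 l ^+ 2.
  rewrite /s !mulr_sumr -sumrB -big_split /=.
  by apply: eq_bigr => l _; ring.
rewrite -!enorm_sqr_row -/a -/b => h.
have : 0 <= 2 * (a * b) * (a * b - s) by apply: (le_trans h); rewrite le_eqVlt; apply/orP; left; apply/eqP; ring.
by rewrite pmulr_rge0 ?subr_ge0//; rewrite mulr_gt0.
Qed.

Lemma ler_enormD q (u v : 'rV[R]_q) : enorm (u + v) <= enorm u + enorm v.
Proof.
rewrite -(@ler_pXn2r _ 2) ?nnegrE ?addr_ge0 ?enorm_ge0//.
rewrite sqrrD !enorm_sqr_row.
have -> : \sum_l (u + v) 0 l ^+ 2 = \sum_l u 0 l ^+ 2 +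
   (\sum_l u 0 l * v 0 l) *+ 2 + \sum_l v 0 l ^+ 2.
  rewrite -sumrMnl -!big_split /=; apply: eq_bigr => l _.
  by rewrite !mxE sqrrD.
by rewrite lerD2r lerD2l lerMn2r cauchy_schwarz.
Qed.

(** The auxiliary zero rows do not contribute, so the Lipschitz constant of
    the driver passes to its dependence on a single row. *)
Lemma enorm_mx_of_row q (l : 'I_q) (v v' : 'rV[R]_q) :
  enorm (mx_of_row l v - mx_of_row l v') = enorm (v - v').
Proof.
rewrite /enorm big_ord1 (bigD1 l)//= [X in _ + X]big1 ?addr0.
  by congr Num.sqrt; apply: eq_bigr => m _; rewrite !mxE eqxx.
by move=> k kl; apply: big1 => m _; rewrite !mxE (negbTE kl) subr0 expr0n.
Qed.

Lemma le0_of_small (a c : R) : (forall e, 0 < e -> a <= e * c) -> a <= 0.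
Proof.
move=> h; rewrite leNgt; apply/negP => a0.
have c0 : 0 < c by rewrite (lt_le_trans a0)//; have := h 1 ltr01; rewrite mul1r.
have := h (a / (2 * c)).
rewrite divr_gt0 ?mulr_gt0// => /(_ isT).
have -> : a / (2 * c) * c = a / 2 by field; rewrite gt_eqF.
lra.
Qed.

(** Rational directions suffice to bound the norm of a vector, so that a bound
    valid almost surely in each fixed direction passes to a random vector. *)
Lemma enorm_rat_dir q (v : 'rV[R]_q) (c e : R) : 0 <= c -> 0 <= e ->
  (forall r : {ffun 'I_q -> rat},
    c * \sum_l ratr (r l) * v 0 l <= enorm (\row_l ratr (r l) : 'rV[R]_q) * e) ->
  c * enorm v <= e.
Proof.
move=> c0 e0 h; set s := enorm v.
have [s0|s0] := eqVneq s 0; first by rewrite s0 mulr0.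
have sp : 0 < s by rewrite lt_neqAle eq_sym s0 enorm_ge0.
rewrite -subr_le0 -(pmulr_rle0 _ sp).
(* approximate v by a rational vector up to t in each entry, and let t tend
   to 0 *)
apply: (@le0_of_small _ (c * (\sum_l `|v 0 l|) + q%:R * e)) => t t0.
have hr l : exists r : rat, `|ratr r - v 0 l| < t.
  have /rat_in_itvoo[r] : v 0 l - t < v 0 l + t.
    by rewrite ltrBlDr -addrA ltrDl addr_gt0.
  rewrite in_itv /= => /andP[h1 h2]; exists r.
  by rewrite distrC ltr_distlC h1 h2.
pose r := [ffun l => projT1 (cid (hr l))].
have rP l : `|ratr (r l) - v 0 l| < t by rewrite ffunE; exact: (projT2 (cid (hr l))).
set u : 'rV[R]_q := \row_l ratr (r l).
have hu : enorm u <= s + q%:R * t.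
  have -> : u = v + (u - v) by rewrite addrC subrK.
  apply: (le_trans (ler_enormD _ _)); rewrite lerD2l.
  apply: (le_trans (enorm_le_sum _)).
  rewrite -[q in q%:R]card_ord mulr_natl -sumr_const; apply: ler_sum => l _.
  by rewrite !mxE ltW.
have hv : s ^+ 2 - t * \sum_l `|v 0 l| <= \sum_l ratr (r l) * v 0 l.
  rewrite enorm_sqr_row mulr_sumr -sumrB; apply: ler_sum => l _.
  have : - (`|ratr (r l) - v 0 l| * `|v 0 l|) <= (ratr (r l) - v 0 l) * v 0 l.
    by rewrite -normrM lerNl; rewrite -normrN ler_norm.
  have : `|ratr (r l) - v 0 l| * `|v 0 l| <= t * `|v 0 l|.
    by rewrite ler_wpM2r// ltW.
  rewrite expr2 mulrBl; lra.
have := h r; rewrite -/u => hh.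
have := ler_wpM2l c0 hv; have := ler_wpM2r e0 hu.
move: hh; rewrite !mulrBr !mulrDl; move=> h1 h2 h3.
have : c * s ^+ 2 - c * (t * \sum_l `|v 0 l|) <= s * e + q%:R * t * e.
  by rewrite (le_trans h3)// (le_trans h1).
by rewrite expr2; nra.
Qed.

Lemma row_mx_of_row q (l : 'I_q) (v : 'rV[R]_q) : row l (mx_of_row l v) = v.
Proof. by apply/rowP => m; rewrite !mxE eqxx. Qed.

Lemma bigmax_abs (I : Type) (s : seq I) (x0 : R) (f : I -> R) :
  `|\big[Num.max/x0]_(i <- s) f i| <= `|x0| + \sum_(i <- s) `|f i|.
Proof.
elim: s => [|i s IH]; first by rewrite !big_nil addr0.
rewrite !big_cons maxEge; case: ifP => _.
  by rewrite addrCA lerDl addr_ge0// sumr_ge0.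
by apply: (le_trans IH); rewrite lerD2l lerDr.
Qed.

End EuclideanNorm.

Section EuclideanNormMeasurability.
Context {R : realType} {disp : measure_display} {Omega : measurableType disp}.
Variable P : probability Omega R.

Lemma enorm_measurable p q (X : Omega -> 'M[R]_(p, q)) :
  (forall k l, measurable_fun setT (fun w => X w k l)) ->
  measurable_fun setT (fun w => enorm (X w) ^+ 2).
Proof.
move=> mX; under eq_fun do rewrite enorm_sqr.
apply: measurable_sum => k; apply: measurable_sum => l.
exact: measurable_funX.
Qed.

Lemma L1_of_enorm p q (X : Omega -> 'M[R]_(p, q)) k l :
  (forall k l, measurable_fun setT (fun w => X w k l)) ->
  (\int[P]_w (enorm (X w) ^+ 2)%:E < +oo)%E -> L1 P (fun w => X w k l).
Proof.
move=> mX fX; apply: L1_of_sqr => //; apply: le_lt_trans fX.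
apply: ge0_le_integral_ae => [w|w|]; rewrite ?lee_fin ?sqr_ge0//.
apply: nearW => w; rewrite lee_fin -(real_normK (num_real _)).
by rewrite lerXn2r ?nnegrE ?enorm_ge0// ler_enorm.
Qed.

End EuclideanNormMeasurability.

(** * Comparison for one backward step *)

Section OneStep.
Context {R : realType} {disp : measure_display} {Omega : measurableType disp}.
Variable P : probability Omega R.
Variable G : set (set Omega).
Hypothesis sG : sigma_algebra setT G.
Hypothesis mG : G `<=` measurable.
Implicit Types X Y W : Omega -> R.

Lemma is_condexp_le X Y X' Y' (A : set Omega) :
  is_condexp P G X Y -> is_condexp P G X' Y' -> G A ->
  {ae P, forall w, A w -> X w <= X' w} -> {ae P, forall w, A w -> Y w <= Y' w}.
Proof.
move=> h h' GA XX'.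
have := is_condexp_ge0 sG mG (is_condexpD sG mG (-1) h h') GA.
have h1 : {ae P, forall w, A w -> 0 <= -1 * X w + X' w}.
  by apply: filterS XX' => w /[apply]; rewrite mulN1r addrC subr_ge0.
by move=> /(_ h1); apply: filterS => w /[apply]; rewrite mulN1r addrC subr_ge0.
Qed.

Lemma is_condexp_cst0 : is_condexp P G (cst 0) (cst 0).
Proof.
split; [exact: L1_cst|exact: L1_cst| |by []].
by apply/measurable_wrtP => //; exact: measurable_cst.
Qed.

Lemma condexp_cst0 : {ae P, forall w, condexp P G (cst 0) w = 0}.
Proof.
have c0 := is_condexp_cst0.
have cE := condexpP sG mG (L1_cst P 0).
have GT := G_setT sG.
have id0 : {ae P, forall w, setT w -> (0 : R) <= 0} by exact: nearW.
have h1 := is_condexp_le c0 cE GT id0.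
have h2 := is_condexp_le cE c0 GT id0.
apply: filterS2 h1 h2 => w /(_ I) h1 /(_ I) h2.
by apply/eqP; rewrite eq_le h1 h2.
Qed.

Lemma condexp_mx_measurable p q (X : Omega -> 'M[R]_(p, q)) :
  measurable_mx_wrt G (condexp_mx P G X).
Proof.
move=> k l; rewrite /condexp_mx; under eq_fun do rewrite mxE.
exact: condexp_measurable.
Qed.

Variable d : nat.
Variable H : Omega -> 'rV[R]_d.
Hypothesis mH : forall l, measurable_fun setT (fun w => H w 0 l).
Variables (h L : R).
Hypothesis h0 : 0 <= h.
Hypothesis HL : {ae P, forall w, h * enorm (H w) * L <= 1}.

Let EH X := condexp_mx P G (fun w => X w *: H w).

(** For a fixed direction q, h L q.H is bounded by |q|, so
    h L q.E[(X' - X) H] <= |q| E[W]; rational directions suffice.  When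
    h L <= 0 there is nothing to bound, and when h L > 0 the weight H is
    bounded, which makes X H integrable for integrable X. *)
Lemma weighted_condexp_le X X' W (A : set Omega) :
  L1 P X -> L1 P X' -> L1 P W -> G A ->
  {ae P, forall w, A w -> `|X' w - X w| <= W w} ->
  {ae P, forall w, A w -> h * L * enorm (EH X' w - EH X w) <= condexp P G W w}.
Proof.
move=> iX iX' iW GA XW.
have cW := condexpP sG mG iW.
have W0 : {ae P, forall w, A w -> 0 <= condexp P G W w}.
  apply: (is_condexp_ge0 sG mG cW GA); apply: filterS XW => w /[apply].
  by apply: le_trans.
have [hL0|hLp] := leP (h * L) 0.
  apply: filterS W0 => w /[apply]; apply: le_trans.
  by rewrite mulr_le0_ge0// enorm_ge0.
have iXH Z l : L1 P Z -> L1 P (fun w => (Z w *: H w) 0 l).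
  move=> iZ; apply: (L1_dom _ (L1Z (h * L)^-1 (L1_abs iZ))).
    under eq_fun do rewrite mxE.
    by apply: measurable_funM => //; exact: L1_meas iZ.
  apply: filterS HL => w hw; rewrite mxE normrM mulrC ler_wpM2r//.
  apply: (le_trans (ler_enorm _ _ _)).
  by rewrite -[leRHS]mul1r ler_pdivlMr// mulrC mulrAC.
have cXH Z l : L1 P Z -> is_condexp P G (fun w => (Z w *: H w) 0 l)
    (fun w => EH Z w 0 l).
  move=> iZ; have := condexpP sG mG (iXH Z l iZ).
  by rewrite /EH /condexp_mx; under [X in _ -> is_condexp _ _ _ X]eq_fun do rewrite mxE.
have dir (r : {ffun 'I_d -> rat}) : {ae P, forall w, A w ->
    h * L * \sum_l ratr (r l) * (EH X' w - EH X w) 0 l <=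
    enorm (\row_l ratr (r l) : 'rV[R]_d) * condexp P G W w}.
  set e := enorm _.
  have c1 l := is_condexpD sG mG (-1) (cXH X l iX) (cXH X' l iX').
  have c2 := is_condexp_sum sG mG (index_enum 'I_d)
    (fun l => h * L * ratr (r l)) c1.
  have c3 := is_condexpD sG mG e cW (is_condexpD sG mG 0 cW c2).
  have c0 := is_condexp_cst0.
  have c4 := is_condexpD sG mG e cW c0.
  have c5 := is_condexpD sG mG 0 cW c2.
  have := is_condexp_le c5 c4 GA.
  set Q1 := (X in (X -> _) -> _); have q1 : Q1; last move=> /(_ q1).
    rewrite /Q1; apply: filterS2 XW HL => w xw hw Aw.
    rewrite mul0r add0r addr0.
    have -> : \sum_l h * L * ratr (r l) * (-1 * (X w *: H w) 0 l + (X' w *: H w) 0 l)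
       = (X' w - X w) * (h * L) * \sum_l (\row_l ratr (r l) : 'rV[R]_d) 0 l * H w 0 l.
      by rewrite mulr_sumr; apply: eq_bigr => l _; rewrite !mxE; ring.
    rewrite (le_trans (ler_norm _))// normrM normrM (gtr0_norm hLp) -mulrA mulrC.
    apply: ler_pM => //; [by rewrite mulr_ge0// ltW| |exact: xw].
    have cs (v : 'rV[R]_d) : `|\sum_l v 0 l * H w 0 l| <= enorm v * enorm (H w).
      rewrite ler_norml cauchy_schwarz andbT lerNl -sumrN.
      have := cauchy_schwarz (- v) (H w).
      rewrite (_ : enorm (- v) = enorm v); last first.
        by rewrite /enorm; congr Num.sqrt; apply: eq_bigr => i _; apply: eq_bigr => j _; rewrite mxE sqrrN.
      by apply: le_trans; apply: ler_sum => l _; rewrite mxE mulNr.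
    apply: (le_trans (ler_wpM2l (ltW hLp) (cs _))).
    rewrite -/e mulrCA -[leRHS]mulr1 ler_wpM2l ?enorm_ge0//.
    by rewrite mulrAC.
  apply: filterS => w hw Aw; have {hw} := hw Aw.
  rewrite mul0r add0r addr0; apply: le_trans; rewrite mulr_sumr le_eqVlt; apply/orP; left.
  by apply/eqP; apply: eq_bigr => l _; rewrite !mxE; ring.
have := ae_forall_count dir; apply: filterS2 W0 => w w0 hw Aw.
by apply: enorm_rat_dir; [exact: ltW|exact: w0|move=> r; exact: hw].
Qed.

Variable F : Omega -> 'M[R]_d -> 'cV[R]_d.
Hypothesis Fdiag : {ae P, forall w, forall l (z z' : 'M[R]_d),
  row l z = row l z' -> F w z l 0 = F w z' l 0}.
Hypothesis Flip : {ae P, forall w, forall z z' : 'M[R]_d,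
  enorm (F w z - F w z') <= L * enorm (z - z')}.

Lemma driver_diff : {ae P, forall w, forall l (v v' : 'rV[R]_d),
  `|F w (mx_of_row l v) l 0 - F w (mx_of_row l v') l 0| <= L * enorm (v - v')}.
Proof.
apply: filterS Flip => w fw l v v'.
rewrite -(enorm_mx_of_row l); apply: le_trans (fw _ _).
by have := ler_enorm (F w (mx_of_row l v) - F w (mx_of_row l v')) l 0; rewrite !mxE.
Qed.

(** Since h L |H| <= 1, the Lipschitz driver can lower E[X' - X] by at most
    E[(X' - X) h L |H|] <= E[X' - X]. *)
Lemma one_step_comparison X X' (A : set Omega) l :
  L1 P X -> L1 P X' -> G A -> {ae P, forall w, A w -> X w <= X' w} ->
  {ae P, forall w, A w ->
    condexp P G X w + h * F w (mx_of_row l (EH X w)) l 0 <=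
    condexp P G X' w + h * F w (mx_of_row l (EH X' w)) l 0}.
Proof.
move=> iX iX' GA XX'.
have iW := L1B iX' iX.
have hW : {ae P, forall w, A w -> `|X' w - X w| <= X' w - X w}.
  by apply: filterS XX' => w /[apply] ?; rewrite ger0_norm// subr_ge0.
have key := weighted_condexp_le iX iX' iW GA hW.
have cW := condexpP sG mG iW.
have cD := is_condexpD sG mG (-1) (condexpP sG mG iX) (condexpP sG mG iX').
have WD : {ae P, forall w, A w -> X' w - X w <= -1 * X w + X' w}.
  by apply: nearW => w _; rewrite mulN1r addrC.
have le1 := is_condexp_le cW cD GA WD.
apply: filterS3 key le1 driver_diff => w k1 k2 k3 Aw.
have {}k1 := k1 Aw; have {}k2 := k2 Aw.
have := k3 l (EH X' w) (EH X w); rewrite ler_norml => /andP[k4 _].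
have := ler_wpM2l h0 k4; move: k1 k2; rewrite mulrN mulrA !mulrBr mulN1r.
lra.
Qed.

(** Compare with the step started from X = 0, where the driver is evaluated
    at the zero matrix. *)
Lemma one_step_L1 X l : L1 P X ->
  (forall M, measurable_mx_wrt G M -> measurable_mx_wrt G (fun w => F w (M w))) ->
  L1 P (fun w => F w 0 l 0) ->
  L1 P (fun w => h * F w (mx_of_row l (EH X w)) l 0).
Proof.
move=> iX mF iF0.
have mE Z : measurable_mx_wrt G (fun w => mx_of_row l (EH Z w)).
  move=> k m; rewrite /mx_of_row; under eq_fun do rewrite mxE.
  case: (k == l); first exact: condexp_mx_measurable.
  by apply/measurable_wrtP => //; exact: measurable_cst.
apply: (@L1_dom _ _ _ _ _ (fun w => condexp P G (fun w => `|X w|) w + h * `|F w 0 l 0|)).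
- apply: measurable_funM => //; apply: (measurable_wrt_fun mG).
  exact: mF.
- apply: L1D; first exact: condexp_L1.
  by apply: L1Z; exact: L1_abs.
- have i0 := L1_cst P (0 : R).
  have hW : {ae P, forall w, setT w -> `|X w - cst 0 w| <= `|X w|}.
    by apply: nearW => w _; rewrite subr0.
  have key := weighted_condexp_le i0 iX (L1_abs iX) (G_setT sG) hW.
  have e0 : {ae P, forall w, EH (cst 0) w = 0}.
    apply: filterS condexp_cst0 => w hw; apply/matrixP => i j.
    rewrite /EH /condexp_mx mxE [RHS]mxE -[RHS]hw; congr (condexp P G _ w).
    by apply/funext => w'; rewrite mxE mul0r.
  apply: filterS3 key driver_diff e0 => w k1 k3 ew.
  have {}k1 := k1 I.
  have := k3 l (EH X w) (EH (cst 0) w); rewrite ew => k4.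
  rewrite ew in k1.
  have m0 : mx_of_row l (0 : 'rV[R]_d) = 0.
    by apply/matrixP => i j; rewrite !mxE; case: ifP.
  rewrite m0 in k4; rewrite normrM (ger0_norm h0).
  have : `|F w (mx_of_row l (EH X w)) l 0| <=
     L * enorm (EH X w - 0) + `|F w 0 l 0|.
    rewrite -[X in `|X|](subrK (F w 0 l 0)) (le_trans (ler_normD _ _))//.
    by rewrite lerD2r.
  move=> /(ler_wpM2l h0); rewrite mulrDr mulrA; lra.
Qed.

End OneStep.

(** * Switching along a path *)

Section Runs.
Context {R : realType} {d : nat}.
Variables (th : nat -> nat) (al : nat -> 'I_d) (c : nat -> 'I_d -> 'I_d -> R).
Hypothesis th_nd : forall r, (th r <= th r.+1)%N.

Lemma th_mono r s : (r <= s)%N -> (th r <= th s)%N.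
Proof.
by move=> /subnK <-; elim: (s - r)%N => // m IH; rewrite addSn (leq_trans IH).
Qed.

(** The regime in force just before index k, when only the first r switches
    are taken into account and the initial regime is in force from the start;
    [run_regime k.+1] is the regime at index k. *)
Fixpoint run_regime (k r : nat) : 'I_d :=
  if r is r'.+1 then if (th r < k)%N then al r else run_regime k r' else al 0.

(** The cost of the first r switches, restricted to those before index k; the
    cost paid exactly at k is [run_cost k.+1 r - run_cost k r]. *)
Definition run_cost (k r : nat) : R :=
  \sum_(1 <= s < r.+1 | (th s < k)%N) c (th s) (al s.-1) (al s).

Lemma run_cost0 k : run_cost k 0 = 0.
Proof. by rewrite /run_cost big_geq. Qed.

Lemma run_costS k r : run_cost k r.+1 =
  run_cost k r + (if (th r.+1 < k)%N then c (th r.+1) (al r) (al r.+1) else 0).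
Proof. by rewrite /run_cost big_mkcond big_nat_recr//= -big_mkcond. Qed.

Lemma run_regime_last K r M : (M <= r)%N -> (0 < M -> th M < K)%N ->
  (M < r -> K <= th M.+1)%N -> run_regime K r = al M.
Proof.
elim: r => [|r IH] /=; first by rewrite leqn0 => /eqP ->.
rewrite leq_eqVlt => /predU1P[->|Mr] h1 h2; first by rewrite h1.
rewrite ltnNge (leq_trans (h2 Mr))//= ?IH//; last exact: th_mono.
by move=> _; apply: h2.
Qed.

Lemma run_cost_stable k r : (th r < k)%N -> run_cost k.+1 r = run_cost k r.
Proof.
move=> tk; rewrite /run_cost big_nat_cond [RHS]big_nat_cond; apply: eq_bigl => s.
case: (boolP (1 <= s < r.+1)%N) => //= /andP[_ sr].
have := @th_mono s r sr; lia.
Qed.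

(** By the triangle inequality, applied once for each switch made at k, so that
    a chain of simultaneous switches is never cheaper than the direct one. *)
Lemma run_cost_ge k r : (forall l, c k l l = 0) ->
  (forall l m p, c k l p <= c k l m + c k m p) ->
  c k (run_regime k r) (run_regime k.+1 r) <= run_cost k.+1 r - run_cost k r.
Proof.
move=> c0 ctri; elim: r => [|r IH]; first by rewrite /= !run_cost0 subrr c0.
rewrite !run_costS /=.
have := th_nd r; case: (ltngtP (th r.+1) k) => h hr.
- rewrite (ltn_trans h)// c0 run_cost_stable ?subrr//.
  exact: leq_ltn_trans hr h.
- by rewrite ltnS leqNgt h /= !addr0.
- rewrite h ltnSn addr0.
  have rE : run_regime k.+1 r = al r.
    by apply: run_regime_last; rewrite ?ltnn// -h => _; rewrite ltnS.
  rewrite rE in IH; apply: (le_trans (ctri _ (al r) _)).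
  by rewrite [leRHS]addrAC lerD2r.
Qed.

Lemma run_const k r : (forall s, (1 <= s)%N -> th s <> k) ->
  run_regime k.+1 r = run_regime k r /\ run_cost k.+1 r = run_cost k r.
Proof.
move=> h; elim: r => [|r [IH1 IH2]] /=; first by rewrite !run_cost0.
have E : (th r.+1 < k.+1)%N = (th r.+1 < k)%N.
  by have := h r.+1 isT; lia.
by rewrite !run_costS E IH1 IH2.
Qed.

Lemma run_cost_mono k k' r : (k <= k')%N ->
  (forall s, (1 <= s)%N -> (th s < k')%N -> 0 <= c (th s) (al s.-1) (al s)) ->
  0 <= run_cost k r <= run_cost k' r.
Proof.
move=> kk c0; elim: r => [|r /andP[IH1 IH2]]; first by rewrite !run_cost0 lexx.
rewrite !run_costS; have [h|h] := ltnP (th r.+1) k.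
  have h' := leq_trans h kk; rewrite h'.
  by rewrite addr_ge0 ?lerD2r//=; exact: c0.
rewrite addr0 IH1 /=; apply: (le_trans IH2); rewrite lerDl.
by case: ifP => // h'; exact: c0.
Qed.

Lemma run_cost_single k r M : (M < r)%N -> th M.+1 = k ->
  (forall s, (1 <= s)%N -> s <> M.+1 -> th s <> k) ->
  run_cost k.+1 r - run_cost k r = c k (al M) (al M.+1).
Proof.
move=> Mr kE h; elim: r Mr => // r IH; rewrite !run_costS => Mr.
move: (Mr); rewrite ltnS leq_eqVlt => /predU1P[ME|Mr'].
  have -> : run_cost k.+1 r = run_cost k r.
    rewrite /run_cost big_nat_cond [RHS]big_nat_cond; apply: eq_bigl => s.
    case: (boolP (1 <= s < r.+1)%N) => //= /andP[s1 sr].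
    by have := h s s1; lia.
  by rewrite -ME kE ltnSn ltnn addr0 addrAC subrr add0r.
have := h r.+1 isT; have -> : (th r.+1 < k.+1)%N = (th r.+1 < k)%N.
  by have := h r.+1 isT; lia.
by rewrite -IH// => _; case: ifP => _; ring.
Qed.

Lemma eseries_finite (Q : pred nat) (f : nat -> \bar R) r :
  (forall s, (r < s)%N -> Q s -> f s = 0%E) ->
  (\sum_(1 <= s <oo | Q s) f s = \sum_(1 <= s < r.+1 | Q s) f s)%E.
Proof.
move=> f0; apply: lim_near_cst => //; exists r.+1 => // m /= rm.
rewrite (big_cat_nat (n := r.+1))//=.
have -> : (\sum_(r.+1 <= s < m | Q s) f s = 0)%E.
  by rewrite big_nat_cond big1// => s /andP[/andP[rs _]]; exact: f0.
by rewrite adde0.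
Qed.

(** A finite total cost leaves room for finitely many genuine switches only,
    each of them costing at least eps. *)
Lemma finite_switches n (eps : R) : 0 < eps ->
  (forall s, (1 <= s)%N -> (th s <= n)%N -> 0 <= c (th s) (al s.-1) (al s)) ->
  (forall s, (1 <= s)%N -> (th s <= n)%N -> al s <> al s.-1 ->
     eps <= c (th s) (al s.-1) (al s)) ->
  (\sum_(1 <= s <oo | (th s <= n)%N) (c (th s) (al s.-1) (al s))%:E < +oo)%E ->
  exists r, forall s, (r < s)%N -> (th s <= n)%N -> al s = al s.-1.
Proof.
move=> e0 c0 ce fin; apply: contrapT => nex.
have bad r : exists s, [/\ (r < s)%N, (th s <= n)%N & al s <> al s.-1].
  apply: contrapT => nb; apply: nex; exists r => s rs sn.
  by apply: contrapT => ns; apply: nb; exists s.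
have big m : exists r, eps *+ m <=
    \sum_(1 <= s < r.+1 | (th s <= n)%N) c (th s) (al s.-1) (al s).
  elim: m => [|m [r hr]].
    by exists 0%N; rewrite big_geq.
  have [s [rs sn sal]] := bad r; exists s.
  rewrite (big_cat_nat (n := r.+1))//=; last by rewrite ltnS ltnW.
  rewrite mulrSr lerD// big_mkcond big_nat_recr//= sn.
  rewrite -[leLHS]add0r lerD//; last by apply: ce => //; lia.
  rewrite big_nat_cond; apply: sumr_ge0 => i /andP[/andP[ri _] _].
  by case: ifP => // tin; apply: c0 => //; lia.
have cE s : (1 <= s)%N -> (th s <= n)%N ->
  (0 <= (c (th s) (al s.-1) (al s))%:E)%E.
  by move=> s1 sn; rewrite lee_fin c0.
set S := (\sum_(_ <= _ <oo | _) _)%E in fin.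
have S0 : (0 <= S)%E by apply: nneseries_ge0.
have Sf : S \is a fin_num by rewrite ge0_fin_numE.
have ub r : \sum_(1 <= s < r.+1 | (th s <= n)%N) c (th s) (al s.-1) (al s) <= fine S.
  rewrite -lee_fin fineK// -sumEFin; apply: nneseries_lim_ge => s s1 sn; exact: cE.
have [r hr] := big (Num.truncn (fine S / eps)).+1.
have := le_trans hr (ub r); rewrite -mulr_natl -ler_pdivlMr//.
by rewrite leNgt truncnS_gt.
Qed.

End Runs.

Section StrategyRuns.
Context {R : realType} {disp : measure_display} {Omega : measurableType disp}.
Variables (d : nat) (D : scheme_data R Omega d).
Local Notation n := (nsteps D).
Implicit Types (a : strategy Omega d) (w : Omega).

Definition path_cost w (k : nat) (l m : 'I_d) : R := scost D (tgrid D k) w l m.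

Local Notation regime_at a w := (run_regime (fun r => sw_time a r w) (fun r => regime a r w)).
Local Notation cost_at a w := (run_cost (fun r => sw_time a r w) (fun r => regime a r w)
  (path_cost w)).

Definition state_set a k w : set 'I_d :=
    [set l | exists r, [/\ regime a r w = l, (sw_time a r w <= k)%N &
       (k < sw_time a r.+1 w)%N \/
       forall s, (r <= s)%N -> (sw_time a s w <= k)%N /\ regime a s w = l]].

Lemma stateE a k w : state a k w = xget (regime a 0 w) (state_set a k w).
Proof. by []. Qed.

Lemma state_set_uniq a k w l l' : (forall r, (sw_time a r w <= sw_time a r.+1 w)%N) ->
  state_set a k w l -> state_set a k w l' -> l = l'.
Proof.
move=> nd [r [<- rk h]] [r' [<- rk' h']].
have mono := th_mono nd.
case: h => h; case: h' => h'.
- have [rr|rr|->//] := ltngtP r r'; [have := mono _ _ rr|have := mono _ _ rr]; lia.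
- have [rr|rr] := leqP r' r; first by have [_ ->] := h' r rr.
  by have := mono _ _ rr; lia.
- have [rr|rr] := leqP r r'; first by have [_ ->] := h r' rr.
  by have := mono _ _ rr; lia.
- have [_ <-] := h (maxn r r') (leq_maxl _ _).
  by have [_ <-] := h' (maxn r r') (leq_maxr _ _).
Qed.

(** Once the later switches up to k are fictitious, the state is that of the
    finite recursion, both when finitely many switch times are at most k and when
    all of them are. *)
Lemma state_run a k w N : (forall r, (sw_time a r w <= sw_time a r.+1 w)%N) ->
  (forall s, (N < s)%N -> (sw_time a s w <= k)%N -> regime a s w = regime a s.-1 w) ->
  state a k w = regime_at a w k.+1 N.
Proof.
move=> nd hN; rewrite stateE.
have mono := th_mono nd.
have [t0|t0] := leqP (sw_time a 0 w) k; last first.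
  rewrite xgetPN; last first.
    move=> l [r [_ rk _]].
    by have := mono _ _ (leq0n r); lia.
  rewrite (@run_regime_last _ _ _ nd _ _ 0)// => _.
  by apply: (leq_trans _ (mono _ _ (leq0n 1%N))).
have [M [MN Mk hM]] : exists M, [/\ (M <= N)%N, (sw_time a M w <= k)%N &
    (M < N -> k < sw_time a M.+1 w)%N].
  elim: N {hN} => [|N [M [MN Mk hM]]]; first by exists 0%N.
  move: MN; rewrite leq_eqVlt => /predU1P[MN|MN].
    have [h|h] := leqP (sw_time a N.+1 w) k; first by exists N.+1; rewrite ltnn.
    by exists M; rewrite MN leqnSn; split => //; rewrite -MN.
  by exists M; split => // [|_]; [rewrite ltnW// ltnW|exact: hM].
rewrite (@run_regime_last _ _ _ nd _ _ M)//.
have uniq := @state_set_uniq a k w _ _ nd.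
suff h : state_set a k w (regime a M w).
  by apply: (uniq _ _ (@xgetPex _ _ (state_set a k w) _)) => //; exists (regime a M w).
move: MN; rewrite leq_eqVlt => /predU1P[MN|MN]; last first.
  by exists M; split => //; left; exact: hM.
have const s : (N <= s)%N -> (sw_time a s w <= k)%N -> regime a s w = regime a N w.
  move=> /subnK <-; elim: (s - N)%N => // m IH; rewrite addSn => h.
  rewrite hN//=; last by rewrite ltnS leq_addl.
  by apply: IH; apply: leq_trans h.
have [[s0 /andP[hs0 hs0']]|all] := pselect (exists s, (N <= s)%N && (k < sw_time a s w)%N).
  have ex : exists s, (N <= s)%N && (k < sw_time a s w)%N by exists s0; rewrite hs0.
  case: (ex_minnP ex) => s /andP[Ns ks] smin.
  have sN : (N < s)%N.
    by rewrite ltn_neqAle Ns andbT; apply/eqP => Es; move: Mk; rewrite MN Es leqNgt ks.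
  case: s sN Ns ks smin => // s sN Ns ks smin.
  have sk : (sw_time a s w <= k)%N.
    rewrite leqNgt; apply/negP => h; have := smin s; rewrite h andbT -ltnS => /(_ sN).
    by rewrite ltnn.
  exists s; split=> //; last by left.
  by rewrite const// MN.
exists M; split => //; right => s; rewrite MN => Ns.
have sk : (sw_time a s w <= k)%N.
  by rewrite leqNgt; apply/negP => h; apply: all; exists s; rewrite Ns.
by split => //; exact: const.
Qed.

Lemma cumcost_run a k w N : (forall k l, (k <= n)%N -> path_cost w k l l = 0) -> (k <= n)%N ->
  (forall s, (N < s)%N -> (sw_time a s w <= n)%N -> regime a s w = regime a s.-1 w) ->
  cumcost D a k w = (cost_at a w k.+1 N)%:E.
Proof.
move=> c0 kn hN; rewrite /cumcost (@eseries_finite _ _ _ N).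
  by rewrite sumEFin.
move=> s Ns sk; rewrite (hN s Ns) ?(leq_trans sk)//; congr EFin.
by apply: c0; exact: leq_trans kn.
Qed.

End StrategyRuns.

(** * Paths of the greedy strategy *)

Lemma bigminn_spec (N : nat) (s : seq nat) (Q : pred nat) :
  let m := \big[minn/N]_(i <- s | Q i) i in
  [/\ (m <= N)%N, forall i, i \in s -> Q i -> (m <= i)%N &
      (m < N)%N -> m \in s /\ Q m].
Proof.
elim: s => [|i s [IH1 IH2 IH3]] /=; first by rewrite big_nil ltnn.
rewrite big_cons; case: (boolP (Q i)) => Qi; last first.
  split => // [k|]; first by rewrite inE => /predU1P[->|]; [rewrite (negbTE Qi)|exact: IH2].
  by move=> /IH3[ms ->]; rewrite inE ms orbT.
set m := (\big[minn/N]_(j <- s | Q j) j) in IH1 IH2 IH3 *.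
split; first by rewrite geq_min IH1 orbT.
  move=> k; rewrite inE => /predU1P[->|ks Qk]; first by rewrite geq_minl.
  by rewrite geq_min (IH2 _ ks Qk) orbT.
rewrite /minn; case: ifP => _; first by rewrite inE eqxx.
by move=> /IH3[ms ->]; rewrite inE ms orbT.
Qed.

(** Unlike in [arg_minnP], the default point may fail the predicate: the
    minimiser does not depend on it once the predicate has a witness. *)
Lemma arg_min_ex (I : finType) (i0 : I) (Q : pred I) (F : I -> nat) :
  (exists i, Q i) -> Q (arg_min i0 Q F).
Proof.
move=> [i Qi]; have -> : arg_min i0 Q F = arg_min i Q F; last by case: (arg_minnP F Qi).
rewrite /arg_min /extremum; case: pickP => //= np.
have [j Qj jm] := arg_minnP F Qi.
by have := np j; rewrite /= Qj /=; have -> // : [forall k, Q k ==> (F j <= F k)%N];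
  apply/forall_inP => k; exact: jm.
Qed.

Section OptimalPaths.
Context {R : realType} {disp : measure_display} {Omega : measurableType disp}.
Variables (P : probability Omega R) (d : nat) (D : scheme_data R Omega d).
Local Notation n := (nsteps D).
Local Notation t := (tgrid D).
Local Notation sv k w := (switch_value P D k w).
Local Notation Yt k w := (Ytilde P D k w).

(** The condition that triggers a switch of the greedy strategy, with the
    maximum unfolded into a real-valued comparison. *)
Definition must_switch (k : nat) (w : Omega) (l : 'I_d) : bool :=
  refl_time D (t k) && [exists m : 'I_d, (m != l) && (Yt k w l 0 <= sv k w l m)].

Lemma best_switch_ge k w l (x : R) : (x%:E <= best_switch P D k w l)%E =
  [exists m : 'I_d, (m != l) && (x <= sv k w l m)].
Proof.
apply/idP/existsP => [|[m /andP[ml xm]]].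
  rewrite /best_switch; elim/big_ind : _ => //.
  - by move=> a b ha hb; rewrite le_max => /orP[/ha|/hb].
  - by move=> m ml xm; exists m; rewrite ml -lee_fin.
apply: (@le_trans _ _ (sv k w l m)%:E); first by rewrite lee_fin.
by rewrite /best_switch; apply: (le_bigmax_cond _ (fun m => (sv k w l m)%:E)).
Qed.

Lemma best_switch_le k w l (x : R) :
  (forall m : 'I_d, m != l -> sv k w l m <= x) -> (best_switch P D k w l <= x%:E)%E.
Proof.
move=> h; apply: bigmax_le => [|m ml]; first exact: leNye.
by rewrite lee_fin h.
Qed.

Lemma best_switch_eq k w l (m : 'I_d) : m != l ->
  ((sv k w l m)%:E == best_switch P D k w l) =
  [forall p : 'I_d, (p != l) ==> (sv k w l p <= sv k w l m)].
Proof.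
move=> ml; apply/eqP/forall_inP => [h p pl|h].
  by rewrite -lee_fin h; apply: (le_bigmax_cond _ (fun m => (sv k w l m)%:E)).
apply/eqP; rewrite eq_le best_switch_le ?andbT//.
by rewrite best_switch_ge; apply/existsP; exists m; rewrite ml lexx.
Qed.

Lemma next_timeE w th l : next_time P D w th l =
  \big[minn/n.+1]_(k <- index_iota th n.+1 | must_switch k w l) k.
Proof. by apply: eq_bigl => k; rewrite /must_switch -best_switch_ge. Qed.

Lemma next_time_le w th l : (next_time P D w th l <= n.+1)%N.
Proof. by rewrite next_timeE; have [] := bigminn_spec n.+1 (index_iota th n.+1) (must_switch ^~ w ^~ l). Qed.

Lemma next_time_min w th l k : (th <= k <= n)%N -> must_switch k w l ->
  (next_time P D w th l <= k)%N.
Proof.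
move=> kn hk; rewrite next_timeE.
have [_ + _] := bigminn_spec n.+1 (index_iota th n.+1) (must_switch ^~ w ^~ l).
by apply => //; rewrite mem_index_iota ltnS.
Qed.

Lemma next_time_in w th l : (next_time P D w th l <= n)%N ->
  (th <= next_time P D w th l)%N /\ must_switch (next_time P D w th l) w l.
Proof.
rewrite next_timeE => h.
have [_ _] := bigminn_spec n.+1 (index_iota th n.+1) (must_switch ^~ w ^~ l).
by rewrite ltnS => /(_ h)[]; rewrite mem_index_iota => /andP[].
Qed.

Lemma next_time_ge w th l : (th <= n.+1)%N -> (th <= next_time P D w th l)%N.
Proof.
move=> hth; have [h|h] := leqP (next_time P D w th l) n.
  by have [] := next_time_in h.
exact: leq_trans hth h.
Qed.

Lemma next_regimeP w k l : (k <= n)%N -> must_switch k w l ->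
  let m := next_regime P D w k l in
  [/\ m != l, Yt k w l 0 <= sv k w l m &
      forall p : 'I_d, p != l -> sv k w l p <= sv k w l m].
Proof.
move=> kn /andP[_ /existsP[m0 /andP[m0l m0Y]]] m.
have : (m != l) && ((sv k w l m)%:E == best_switch P D k w l).
  rewrite /m /next_regime kn.
  apply: (@arg_min_ex _ _ (fun m => (m != l) && ((sv k w l m)%:E == best_switch P D k w l))).
  pose p := [arg max_(p > m0 | p != l) sv k w l p]%O.
  exists p; rewrite /p; case: arg_maxP => //= q ql qm.
  by rewrite ql best_switch_eq//; apply/forall_inP => r; exact: qm.
move=> /andP[ml]; rewrite best_switch_eq// => /forall_inP hm; split => //.
by apply: (le_trans m0Y); exact: hm.
Qed.

Variables (i : nat) (j : 'I_d) (w : Omega).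
Hypothesis hin : (i <= n)%N.
Local Notation th r := (sw_time (opt_strategy P D i j) r w).
Local Notation al r := (regime (opt_strategy P D i j) r w).

Lemma opt_timeS r : th r.+1 = next_time P D w (th r) (al r).
Proof. by []. Qed.

Lemma opt_regimeS r : al r.+1 = next_regime P D w (th r.+1) (al r).
Proof. by []. Qed.

Lemma opt_time_le r : (th r <= n.+1)%N.
Proof. by case: r => [|r]; [exact: leqW|exact: next_time_le]. Qed.

Lemma opt_time_nd r : (th r <= th r.+1)%N.
Proof. by rewrite opt_timeS next_time_ge// opt_time_le. Qed.

Lemma opt_switch r : (th r.+1 <= n)%N -> must_switch (th r.+1) w (al r).
Proof. by rewrite opt_timeS => /next_time_in[]. Qed.

Lemma opt_no_switch r k : (th r <= k)%N -> (k < th r.+1)%N -> (k <= n)%N ->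
  ~~ must_switch k w (al r).
Proof.
move=> h1 h2 kn; apply/negP => h.
have := @next_time_min w (th r) (al r) k; rewrite h1 kn -opt_timeS => /(_ isT h).
by rewrite leqNgt h2.
Qed.

Local Notation c := (path_cost D w).
Hypothesis cdiag : forall k l, (k <= n)%N -> c k l l = 0.
Hypothesis ctri : forall k l m p, (k <= n)%N -> l != m -> m != p -> c k l p < c k l m + c k m p.

(** Two switches at the same time would cost strictly more than the direct
    one, against the optimality of the first. *)
Lemma opt_time_lt r : (th r.+1 <= n)%N -> (th r.+1 < th r.+2)%N.
Proof.
move=> h; rewrite ltn_neqAle opt_time_nd andbT; apply/eqP => E.
have h' : (th r.+2 <= n)%N by rewrite -E.
have := next_regimeP h' (opt_switch h'); rewrite -opt_regimeS -E.
have := next_regimeP h (opt_switch h); rewrite -opt_regimeS.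
move=> [m1 _ m3] [p1 p2 _].
have := @ctri (th r.+1) (al r) (al r.+1) (al r.+2) h.
rewrite eq_sym m1 eq_sym p1 => /(_ isT isT).
move: p2; have [->|pl] := eqVneq (al r.+2) (al r).
  have [] := next_regimeP h (opt_switch h); rewrite -opt_regimeS => _ + _.
  have := cdiag (al r) h; rewrite /switch_value /path_cost; lra.
have := m3 _ pl; rewrite /switch_value /path_cost; lra.
Qed.

Lemma opt_time_gt r : (n.+1 < r)%N -> (n < th r)%N.
Proof.
case: r => // r; rewrite ltnS => nr.
suff h s : (s <= th s.+1)%N || (n < th s.+1)%N.
  by have /orP[|//] := h r; apply: leq_trans.
elim: s => // s; have [hs|hs _] := leqP (th s.+1) n; last first.
  by rewrite (leq_trans hs (opt_time_nd _)) orbT.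
rewrite orbF => IH; apply/orP; left.
exact: leq_ltn_trans IH (opt_time_lt hs).
Qed.

Local Notation N := n.+2.
Local Notation rr k := (run_regime (fun r => th r) (fun r => al r) k N).
Local Notation rc k := (run_cost (fun r => th r) (fun r => al r) c k N).

(** The cost paid by the greedy strategy at index k turns the unprojected
    value in the new regime into the projected value in the old one.  With M
    the last switch before k, either the next switch is exactly at k and
    selects the maximum, or it is later and staying is the maximum. *)
Lemma opt_run_step k (Y : 'I_d -> R) : (i <= k <= n)%N ->
  (if refl_time D (t k) then
     (forall l m, sv k w l m <= Y l) /\ (forall l, exists m, Y l = sv k w l m)
   else forall l, Y l = Yt k w l 0) ->
  Yt k w (rr k.+1) 0 - (rc k.+1 - rc k) = Y (rr k).
Proof.
move=> /andP[ik kn] hY.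
have svd l : sv k w l l = Yt k w l 0.
  by rewrite /switch_value -/(path_cost D w k l l) cdiag// subr0.
have nd := opt_time_nd; have mono := th_mono nd.
have thN : (k < th N)%N by apply: leq_ltn_trans kn (opt_time_gt _).
have [M [MN Mk hM]] : exists M, [/\ (M <= N)%N, (0 < M -> th M < k)%N &
    (M < N -> k <= th M.+1)%N].
  move: (N) => r; elim: r => [|r [M [MN Mk hM]]]; first by exists 0%N.
  move: MN; rewrite leq_eqVlt => /predU1P[MN|MN].
    have [h|h] := ltnP (th r.+1) k; first by exists r.+1; rewrite ltnn.
    by exists M; rewrite MN leqnSn; split => //; rewrite -MN.
  by exists M; split => // [|_]; [rewrite ltnW// ltnW|exact: hM].
have {}MN : (M < N)%N.
  rewrite ltn_neqAle MN andbT; apply/eqP => E.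
  by move: Mk thN; rewrite E => /(_ isT); lia.
have {}hM := hM MN.
have Mk' : (th M <= k)%N by move: Mk; case: (M) => [_ //|M' /(_ isT)/ltnW].
rewrite [rr k](@run_regime_last _ _ _ nd _ _ M)//; last by rewrite ltnW.
move: hM; rewrite leq_eqVlt => /predU1P[kE|kM].
  have h : (th M.+1 <= n)%N by rewrite -kE.
  have k2 : (k < th M.+2)%N by rewrite kE opt_time_lt.
  have [h1 h2 h3] := next_regimeP h (opt_switch h).
  have /andP[hr _] := opt_switch h.
  rewrite -opt_regimeS -kE in h1 h2 h3.
  rewrite -kE in hr; rewrite hr in hY.
  rewrite (@run_regime_last _ _ _ nd _ _ M.+1)//; last by rewrite -kE.
  rewrite (@run_cost_single _ _ _ _ _ _ _ M)//; last first.
    move=> s s1 sM; have [sM'|sM'] := leqP s M.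
      by have := mono _ _ sM'; have := Mk (leq_trans s1 sM'); lia.
    have : (M.+2 <= s)%N by lia.
    by move=> /mono; lia.
  have [Ym1 Ym2] := hY.
  have [p Yp] := Ym2 (al M).
  apply/eqP; rewrite eq_le {2}Yp; apply/andP; split; first exact: Ym1.
  have [pl|pl] := eqVneq p (al M); last exact: h3.
  by apply: le_trans h2; rewrite pl svd.
rewrite (@run_regime_last _ _ _ nd _ _ M)//; last by rewrite ltnW.
have -> : rc k.+1 = rc k.
  suff hne s : (1 <= s)%N -> th s <> k.
    by have [_ ->] := run_const (fun r => al r) c N hne.
  move=> s1; have [sM|sM] := leqP s M.
    by have := mono _ _ sM; have := Mk (leq_trans s1 sM); lia.
  by have := mono _ _ sM; lia.
rewrite subrr subr0.
have := opt_no_switch Mk' kM kn; rewrite negb_and.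
case: ifP hY => [hr [Ym1 Ym2] /= ns|_ -> //].
have [p Yp] := Ym2 (al M).
apply/eqP; rewrite eq_le; apply/andP; split.
  by have := Ym1 (al M) (al M); rewrite svd.
rewrite Yp; have [->|pl] := eqVneq p (al M).
  by rewrite svd.
move: ns; rewrite negb_exists => /forallP/(_ p); rewrite pl /= -ltNge => /ltW.
exact.
Qed.

End OptimalPaths.

(** * The filtration on the grid *)

Section Filtration.
Context {R : realType} {disp : measure_display} {Omega : measurableType disp}.
Variables (P : probability Omega R) (T : R) (d : nat).
Variables (W : R -> Omega -> 'rV[R]_d) (D : scheme_data R Omega d).
Hypothesis hW : brownian_motion P T W.
Hypothesis hfilt : brownian_filtration P T W (filt D).
Hypothesis hgrids : grids_ok T D.
Local Notation n := (nsteps D).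
Local Notation t := (tgrid D).

Lemma grid_le k m : (k <= m)%N -> (m <= n)%N -> t k <= t m.
Proof.
have [[_ _ inc] _ _] := hgrids.
move=> /subnK <-; elim: (m - k)%N => // q IH; rewrite addSn => h.
by apply: (le_trans (IH (ltnW h))); apply/ltW/inc.
Qed.

Lemma grid_in k : (k <= n)%N -> 0 <= t k <= T.
Proof.
have [[t0 tn _] _ _] := hgrids.
by move=> kn; rewrite -{1}t0 -tn !grid_le.
Qed.

Lemma step_gt0 k : (k < n)%N -> 0 < step D k.
Proof. by have [[_ _ inc] _ _] := hgrids; move=> /inc; rewrite /step subr_gt0. Qed.

Lemma filtkE k : (k <= n)%N -> filtk D k = filt D (t k).
Proof. by move=> kn; rewrite /filtk (minn_idPl kn). Qed.

Lemma filtk_sigma k : sigma_algebra setT (filtk D k).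
Proof. by have [h _ _] := hfilt; apply: h; apply: grid_in; exact: geq_minr. Qed.

Lemma filt_meas s : 0 <= s <= T -> filt D s `<=` measurable.
Proof.
move=> sT; have [_ _ h] := hfilt; have [_ h2] := h s sT.
apply: (subset_trans h2).
have [mW _ _ _] := hW.
apply: smallest_sub; first exact: sigma_algebra_measurable.
move=> A [|[]//]; apply: smallest_sub; first exact: sigma_algebra_measurable.
move=> _ [u [k [B [us mB ->]]]]; rewrite -[X in measurable X]setTI; apply: mW => //.
by case/andP: us => -> /=; move: sT => /andP[_ sT] /le_trans; apply.
Qed.

Lemma filtk_meas k : filtk D k `<=` measurable.
Proof. by apply: filt_meas; apply: grid_in; exact: geq_minr. Qed.

Lemma filtk_le k m : (k <= m)%N -> filtk D k `<=` filtk D m.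
Proof.
move=> km; have [_ h _] := hfilt; apply: h.
- by have /andP[] := @grid_in (minn k n) (geq_minr _ _).
- by apply: grid_le; rewrite ?geq_minr// leq_min geq_minr andbT geq_min km.
- by have /andP[] := @grid_in (minn m n) (geq_minr _ _).
Qed.

End Filtration.

(** * Measurability of the reflected scheme *)

Section Schemes.
Context {R : realType} {disp : measure_display} {Omega : measurableType disp}.
Variables (P : probability Omega R) (T : R) (d : nat).
Variables (W : R -> Omega -> 'rV[R]_d) (D : scheme_data R Omega d).
Hypothesis hW : brownian_motion P T W.
Hypothesis hfilt : brownian_filtration P T W (filt D).
Hypothesis hgrids : grids_ok T D.
Hypothesis hC : cost_process P T D.
Hypothesis hxi : terminal_ok P T D.
Variables (lambda Lambda : R) (lam : nat -> R).
Hypothesis hH : weights_ok P D lambda Lambda lam.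
Hypothesis hFmeas : driver_measurable D.
Variable eps : R.
Hypothesis hCstruct : cost_structure P T D eps.
Hypothesis hFdiag : driver_diagonal P D.
Variable LZ : R.
Hypothesis hFlip : driver_lipschitz P D LZ.
Variable Cp : R.
Hypothesis hmom : moment_bound P D Cp.
Hypothesis hHbound : weights_bounded P D LZ.

Local Notation n := (nsteps D).
Local Notation t := (tgrid D).
Local Notation C := (scost D).
Local Notation xi := (terminal D).
Local Notation F := (driver D).
Local Notation H := (weight D).
Local Notation Yr := (Yrefl P D).
Local Notation Yt := (Ytilde P D).
Local Notation c := (path_cost D).

Let sG := filtk_sigma hfilt hgrids.
Let mG := filtk_meas hW hfilt hgrids.
Let Gle := filtk_le hfilt hgrids.

Lemma cost_measurable k : (k <= n)%N -> measurable_mx_wrt (filtk D k) (C (t k)).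
Proof.
move=> kn; rewrite filtkE//; have [mC _] := hC.
by apply: mC; exact: (grid_in hgrids kn).
Qed.

Lemma xi_measurable : measurable_mx_wrt (filtk D n) xi.
Proof.
have [mxi _ _] := hxi; have [[_ tn _] _ _] := hgrids.
by rewrite filtkE// tn.
Qed.

Lemma driver_comp k (M : Omega -> 'M[R]_d) : (k < n)%N ->
  measurable_mx_wrt (filtk D k) M -> measurable_mx_wrt (filtk D k) (fun w => F k w (M w)).
Proof.
move=> kn; apply: (measurable_mx_comp (sG k)) => l m B mB.
have := hFmeas l kn mB; rewrite -filtkE ?(ltnW kn)//.
by rewrite (ord1 m).
Qed.

Lemma Ytilde_measurable k : (k <= n)%N -> measurable_mx_wrt (filtk D k) (Yt k).
Proof.
rewrite leq_eqVlt => /predU1P[->|kn]; first by rewrite Ytilde_n; exact: xi_measurable.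
rewrite /Ytilde kn => l m; rewrite /Ytstep.
under eq_fun do rewrite !mxE.
apply: (measurable_wrtD (sG k)).
  have := condexp_mx_measurable P (sG k) (Yr k.+1) l m.
  by rewrite /condexp_mx; under eq_fun do rewrite mxE.
apply: (measurable_wrtZ (sG k)); apply: (driver_comp kn) => l' m'.
exact: (condexp_mx_measurable P (sG k)).
Qed.

Lemma switch_value_measurable k l m : (k <= n)%N ->
  measurable_wrt (filtk D k) (fun w => switch_value P D k w l m).
Proof.
move=> kn; apply: (measurable_wrtB (sG k)); first exact: Ytilde_measurable.
exact: cost_measurable.
Qed.

Lemma Yrefl_measurable k : (k <= n)%N -> measurable_mx_wrt (filtk D k) (Yr k).
Proof.
move=> kn l m; move: (kn); rewrite leq_eqVlt => /predU1P[->|kn'].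
  by rewrite Yrefl_n; exact: xi_measurable.
rewrite (_ : (fun _ => _) = fun w => if refl_time D (t k) then
    omax (C (t k) w) (Yt k w) l else Yt k w l m); last first.
  by apply/funext => w; rewrite YreflE//; case: ifP => // _; rewrite mxE.
case: (refl_time D (t k)); last exact: Ytilde_measurable.
by apply: (measurable_wrt_bigmax (sG k)) => [|p]; exact: switch_value_measurable.
Qed.

(** * Integrability of the reflected scheme *)

Lemma moment_sub (f : Omega -> R) : (forall w, 0 <= f w) ->
  (forall w, f w <= enorm (xi w) ^+ 2
     + \sum_(k < n) enorm (F k w 0) ^+ 2 * step D k
     + \big[Num.max/0]_(k < n.+1 | refl_time D (t k)) enorm (C (t k) w) ^+ 2) ->
  (\int[P]_w (f w)%:E < +oo)%E.
Proof.
move=> f0 fle; apply: (@le_lt_trans _ _ Cp%:E); last exact: ltry.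
apply: le_trans hmom; apply: ge0_le_integral_ae => [w|w|]; rewrite ?lee_fin//.
  exact: (le_trans (f0 w)).
by apply: nearW => w; rewrite lee_fin.
Qed.

Lemma moment_ge0 w :
  [/\ 0 <= enorm (xi w) ^+ 2,
   forall k, (k < n)%N -> 0 <= enorm (F k w 0) ^+ 2 * step D k,
   0 <= \sum_(k < n) enorm (F k w 0) ^+ 2 * step D k &
   0 <= \big[Num.max/0]_(k < n.+1 | refl_time D (t k)) enorm (C (t k) w) ^+ 2].
Proof.
have h k : (k < n)%N -> 0 <= enorm (F k w 0) ^+ 2 * step D k.
  by move=> kn; rewrite mulr_ge0 ?sqr_ge0// ltW// (step_gt0 hgrids).
split => //; first exact: sqr_ge0.
  by apply: sumr_ge0 => k _; exact: h.
exact: bigmax_ge_id.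
Qed.

Lemma xi_L1 l : L1 P (fun w => xi w l 0).
Proof.
apply: L1_of_enorm => [k m|].
  exact: (measurable_wrt_fun (@mG n) (xi_measurable _ _)).
apply: moment_sub => w; have [h1 _ h2 h3] := moment_ge0 w => //.
by rewrite -addrA lerDl addr_ge0.
Qed.

Lemma driver0_L1 k l : (k < n)%N -> L1 P (fun w => F k w 0 l 0).
Proof.
move=> kn; apply: L1_of_enorm => [p m|].
  apply: (measurable_wrt_fun (@mG k)); apply: (driver_comp kn) => p' m'.
  by apply/(measurable_wrtP (sG k)); exact: measurable_cst.
have s0 := step_gt0 hgrids kn.
have : (\int[P]_w (enorm (F k w 0) ^+ 2 * step D k)%:E < +oo)%E.
  apply: moment_sub => w; have [h1 h h2 h3] := moment_ge0 w; first exact: h.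
  rewrite -addrA -[leLHS]add0r lerD// -[leLHS]addr0 lerD//.
  rewrite (bigD1 (Ordinal kn))//= lerDl; apply: sumr_ge0 => q _; exact: h.
have mE : measurable_fun setT (fun w => enorm (F k w 0) ^+ 2).
  apply: enorm_measurable => p m.
  apply: (measurable_wrt_fun (@mG k)); apply: (driver_comp kn) => p' m'.
  by apply/(measurable_wrtP (sG k)); exact: measurable_cst.
move=> fin.
have : L1 P (fun w => enorm (F k w 0) ^+ 2 * step D k).
  apply/integrableP; split.
    by apply/measurable_EFinP; exact: measurable_funM.
  apply: le_lt_trans fin; apply: ge0_le_integral_ae => [//|w|].
    by rewrite lee_fin mulr_ge0 ?sqr_ge0// ltW.
  by apply: nearW => w; rewrite /= lee_fin ger0_norm// mulr_ge0 ?sqr_ge0// ltW.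
move=> /(L1Z (step D k)^-1) /integrableP[_]; apply: le_lt_trans.
apply: ge0_le_integral_ae => [w|//|]; first by rewrite lee_fin sqr_ge0.
apply: nearW => w /=; rewrite lee_fin mulrC mulfK ?gt_eqF//.
exact: ler_norm.
Qed.

Lemma cost_sqr_fin k : (k <= n)%N -> refl_time D (t k) ->
  (\int[P]_w (enorm (C (t k) w) ^+ 2)%:E < +oo)%E.
Proof.
move=> kn hk; apply: moment_sub => w; first exact: sqr_ge0.
have [h1 _ h2 h3] := moment_ge0 w; rewrite -[leLHS]add0r lerD ?addr_ge0//.
have kn' : (k < n.+1)%N by rewrite ltnS.
exact: (le_bigmax_cond _ (j := Ordinal kn') (fun q : 'I_n.+1 => enorm (C (t q) w) ^+ 2)).
Qed.

Lemma cost_L1 k l m : (k <= n)%N -> refl_time D (t k) -> L1 P (fun w => C (t k) w l m).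
Proof.
move=> kn hk; apply: L1_of_enorm => [p q|]; last exact: cost_sqr_fin.
exact: (measurable_wrt_fun (@mG k) (cost_measurable kn _ _)).
Qed.

Local Notation EH k X := (condexp_mx P (filtk D k) (fun w => X w *: H k w)).

Lemma weight_measurable k l : (k < n)%N -> measurable_fun setT (fun w => H k w 0 l).
Proof.
move=> kn; have [_ mH _ _ _] := hH.
have hm := mH k kn 0 l; move=> _ B mB; rewrite setTI.
apply: (filt_meas hW hfilt (grid_in hgrids kn)); exact: hm.
Qed.

Lemma Zrefl_row k l w : row l (Zrefl P D k w) = EH k (fun w => Yr k.+1 w l 0) w.
Proof.
apply/rowP => m; rewrite !mxE; congr (condexp P _ _ w); apply/funext => w'.
by rewrite !mxE big_ord1.
Qed.

Lemma Ytilde_ae k l : (k < n)%N -> {ae P, forall w, Yt k w l 0 =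
  condexp P (filtk D k) (fun w => Yr k.+1 w l 0) w +
  step D k * F k w (mx_of_row l (EH k (fun w => Yr k.+1 w l 0) w)) l 0}.
Proof.
move=> kn; apply: filterS (hFdiag kn) => w hw.
rewrite YtildeE// !mxE; congr (_ + _ * _).
by apply: hw; rewrite Zrefl_row row_mx_of_row.
Qed.

(** The driver at zero is square integrable and the rest is controlled by the
    previous value, so that integrability goes through the backward
    recursion. *)
Lemma step_driver_L1 k X l : (k < n)%N -> L1 P X ->
  L1 P (fun w => step D k * F k w (mx_of_row l (EH k X w)) l 0).
Proof.
move=> kn iX; apply: (one_step_L1 (sG k) (@mG k) _ _ (hHbound kn) (hFlip kn)) => //.
- by move=> p; exact: weight_measurable.
- exact/ltW/(step_gt0 hgrids).
- by move=> M; exact: driver_comp.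
- exact: driver0_L1.
Qed.

Lemma Ytilde_L1_of k l : (k < n)%N -> L1 P (fun w => Yr k.+1 w l 0) ->
  L1 P (fun w => Yt k w l 0).
Proof.
move=> kn iY; have iE := L1D (condexp_L1 P (filtk D k) (fun w => Yr k.+1 w l 0))
  (step_driver_L1 l kn iY).
apply: (L1_dom _ (L1_abs iE)).
  exact: (measurable_wrt_fun (@mG k) (Ytilde_measurable (ltnW kn) _ _)).
by apply: filterS (Ytilde_ae l kn) => w ->.
Qed.

Lemma Yrefl_L1 k l : (k <= n)%N -> L1 P (fun w => Yr k w l 0).
Proof.
move=> kn; have [q qE] : exists q, (q + k = n)%N by exists (n - k)%N; rewrite subnK.
elim: q k l kn qE => [|q IH] k l kn qE.
  by move: qE; rewrite add0n => ->; rewrite Yrefl_n; exact: xi_L1.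
have kn' : (k < n)%N by rewrite -qE addSn ltnS leq_addl.
have iY m : L1 P (fun w => Yt k w m 0).
  by apply: Ytilde_L1_of => //; apply: IH => //; rewrite addnS -addSn.
have mY := measurable_wrt_fun (@mG k) (Yrefl_measurable kn l 0).
have E w : Yr k w l 0 = if refl_time D (t k) then
    omax (C (t k) w) (Yt k w) l else Yt k w l 0.
  by rewrite YreflE//; case: ifP => // _; rewrite mxE.
case: (boolP (refl_time D (t k))) => hk; last first.
  by apply: L1_ext (iY l) => w; rewrite E (negbTE hk).
have iS m : L1 P (fun w => Yt k w m 0 - C (t k) w l m).
  by apply: L1B => //; exact: cost_L1.
apply: (L1_dom mY (L1D (L1_abs (iS l)) (L1_sum (index_enum 'I_d) (Q := xpredT) (fun m _ => L1_abs (iS m))))).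
by apply: nearW => w; rewrite E hk; exact: bigmax_abs.
Qed.


(** * Admissible strategies *)

Lemma path_good : {ae P, forall w,
  [/\ forall k l, (k <= n)%N -> c w k l l = 0,
      forall k l m, (k <= n)%N -> l != m -> eps <= c w k l m &
      forall k l m p, (k <= n)%N -> l != m -> m != p -> c w k l p < c w k l m + c w k m p]}.
Proof.
have [_] := hCstruct; apply: filterS => w [h1 h2 h3]; split.
- by move=> k l kn; apply: h1; exact: (grid_in hgrids kn).
- move=> k l m kn lm; rewrite -lee_fin; apply: (le_trans (h2 l m lm)).
  apply: ereal_inf_lbound; exists (t k) => //=.
  by rewrite in_itv /= (grid_in hgrids kn).
- move=> k l m p kn lm mp; rewrite -subr_gt0 -lte_fin.
  apply: (lt_le_trans (h3 l m p lm mp)); apply: ereal_inf_lbound.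
  by exists (t k) => //=; rewrite in_itv /= (grid_in hgrids kn).
Qed.

Lemma eps_gt0 : 0 < eps. Proof. by case: hCstruct. Qed.

Lemma path_good_ge0 w : (forall k l, (k <= n)%N -> c w k l l = 0) ->
  (forall k l m, (k <= n)%N -> l != m -> eps <= c w k l m) ->
  forall k l m, (k <= n)%N -> 0 <= c w k l m.
Proof.
move=> h1 h2 k l m kn; have [->|lm] := eqVneq l m; first by rewrite h1.
by apply: le_trans (h2 _ _ _ kn lm); exact/ltW/eps_gt0.
Qed.

Lemma path_good_tri w : (forall k l, (k <= n)%N -> c w k l l = 0) ->
  (forall k l m p, (k <= n)%N -> l != m -> m != p -> c w k l p < c w k l m + c w k m p) ->
  forall k l m p, (k <= n)%N -> c w k l p <= c w k l m + c w k m p.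
Proof.
move=> h1 h2 k l m p kn; have [->|lm] := eqVneq l m; first by rewrite h1// add0r.
have [->|mp] := eqVneq m p; first by rewrite (h1 k p)// addr0.
by apply: ltW; exact: h2.
Qed.

Section StrategyMeasurability.
Variable a : strategy Omega d.
Hypothesis ha : is_strategy D a.

Lemma strategy_le r k : filtk D k [set w | (sw_time a r w <= k)%N].
Proof. by have [_ h _] := ha. Qed.

Lemma strategy_eq r k : filtk D k [set w | sw_time a r w = k].
Proof.
rewrite (_ : [set w | _] = [set w | (sw_time a r w <= k)%N] `&`
    ~` (if k is k'.+1 then [set w | (sw_time a r w <= k')%N] else set0)).
  apply: (G_setI (sG k)); first exact: strategy_le.
  apply: (G_setC (sG k)); case: k => [|k]; first by have [] := sG 0.
  by apply: (Gle (leqnSn k)); exact: strategy_le.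
by apply/seteqP; case: k => [|k]; split => w /=; lia.
Qed.

Lemma strategy_regime r l k :
  filtk D k ([set w | regime a r w = l] `&` [set w | (sw_time a r w <= k)%N]).
Proof. by have [_ _ h] := ha. Qed.

(** The state is read off the first alternative of its definition when some
    switch is the last one up to k, off the second one when the regimes are
    eventually constant, and is the initial regime otherwise; each of these
    is an event of the step. *)
Lemma state_measurable k l : (forall m, filtk D k [set w | regime a 0 w = m]) ->
  filtk D k [set w | state a k w = l].
Proof.
move=> h0; have [nd _ _] := ha.
pose S m := [set w | state_set a k w m].
have mS m : filtk D k (S m).
  apply: (G_exists (sG k)) => r.
  rewrite (_ : (fun _ => _) = ([set w | regime a r w = m] `&` [set w | (sw_time a r w <= k)%N])
    `&` ~` ([set w | (sw_time a r.+1 w <= k)%N] `&` ~` [set w | forall s,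
       ([set _ | (r <= s)%N -> False] `|` ([set w | regime a s w = m] `&` [set w | (sw_time a s w <= k)%N])) w])).
    apply: (G_setI (sG k)); first exact: strategy_regime.
    apply: (G_setC (sG k)); apply: (G_setI (sG k)); first exact: strategy_le.
    apply: (G_setC (sG k)); apply: (G_forall (sG k)) => s.
    rewrite -[X in filtk D k X]setCK; apply: (G_setC (sG k)); rewrite setCU.
    apply: (G_setI (sG k)); apply: (G_setC (sG k)); first exact: G_const.
    exact: strategy_regime.
  apply/funext => w; apply/propext; split=> /=.
    move=> [h1 h2 h3]; split => // -[h4 h5]; case: h3 => [|h3]; first by rewrite ltnNge h4.
    apply: h5 => s; have [rs|rs] := leqP r s; last by left; lia.
    by have [] := h3 s rs; right.
  move=> [[h1 h2] h3]; split => //.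
  have [h4|h4] := leqP (sw_time a r.+1 w) k; last by left.
  right => s rs; apply: contrapT => h5; apply: h3; split => // h6.
  by case: (h6 s) => [/(_ rs)//|[h7 h8]]; apply: h5.
rewrite (_ : [set w | _] = ~` (~` S l `&` ~` (~` [set w | exists m, S m w] `&`
    [set w | regime a 0 w = l]))).
  do !(apply: (G_setC (sG k)) || apply: (G_setI (sG k)) || apply: mS || apply: h0 ||
       apply: (G_exists (sG k)) || move=> ?).
apply/seteqP; split => w /=.
  rewrite stateE => sl [nS nh].
  have [ex|nex] := pselect (exists m, S m w).
    by apply: nS; rewrite -sl; exact: xgetPex.
  by apply: nh; split => //; rewrite -sl xgetPN// => m Sm; apply: nex; exists m.
move=> h; rewrite stateE.
have [Sl|nSl] := pselect (S l w).
  by apply: (@state_set_uniq _ _ _ a k w) => //; exact: xgetPex (ex_intro _ l Sl).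
have [[nex r0]|nh] := pselect ((~ exists m, S m w) /\ regime a 0 w = l).
  by rewrite xgetPN// => m Sm; apply: nex; exists m.
by exfalso; apply: h.
Qed.

(** On the event that the r-th switch occurs at m between l and p, the r-th term is
    the entry (l, p) of the cost at t_m; there are countably many such
    events. *)
Lemma cumcost_measurable k : (k <= n)%N -> measurable_fun setT (cumcost D a k).
Proof.
move=> kn; rewrite /cumcost; apply: measurable_fun_limn => N.
under eq_fun do rewrite big_mkcond; apply: emeasurable_sum => r /= _ B mB.
have sM := sigma_algebra_measurable Omega.
have [nd _ _] := ha.
rewrite setTI (_ : _ @^-1` B =
  ~` [set w | (sw_time a r w <= k)%N] `&` [set _ | B 0%E] `|`
  [set w | exists x : 'I_k.+1 * ('I_d * 'I_d),
    ([set w | sw_time a r w = x.1] `&`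
     (([set w | regime a r.-1 w = x.2.1] `&` [set w | (sw_time a r.-1 w <= x.1)%N]) `&`
     (([set w | regime a r w = x.2.2] `&` [set w | (sw_time a r w <= x.1)%N]) `&`
      [set w | B (C (t x.1) w x.2.1 x.2.2)%:E]))) w]).
  apply: measurableU; first apply: measurableI.
  - by apply: measurableC; apply: (@mG k); exact: strategy_le.
  - exact: G_const sM _.
  - apply: (G_exists sM) => -[m [l p]] /=.
    have mn : (m <= n)%N by apply: leq_trans kn; rewrite -ltnS.
    apply: (@mG m); apply: (G_setI (sG m)); first exact: strategy_eq.
    apply: (G_setI (sG m)); first exact: strategy_regime.
    apply: (G_setI (sG m)); first exact: strategy_regime.
    apply: (cost_measurable mn l p (B := [set x | B x%:E])).
    by have := @EFin_measurable R setT measurableT B mB; rewrite setTI.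
apply/seteqP; split => w /=.
  case: ifPn => h; last by left.
  right; have hk : (sw_time a r w < k.+1)%N by rewrite ltnS.
  exists (Ordinal hk, (regime a r.-1 w, regime a r w)) => /=; do !split => //.
  by case: (r) => // q; exact: nd.
by move=> [[/negP/negbTE -> //]|[[m [l p]] /= [-> [[-> _] [[-> _] h]]]]]; rewrite -ltnS ltn_ord.
Qed.

End StrategyMeasurability.

Local Notation rr a w k N := (run_regime (fun r => sw_time a r w) (fun r => regime a r w) k N).
Local Notation rc a w k N := (run_cost (fun r => sw_time a r w) (fun r => regime a r w) (c w) k N).

Section Admissible.
Variables (i : nat) (j : 'I_d) (a : strategy Omega d).
Hypothesis hi : (i <= n)%N.
Hypothesis ha : admissible P D i j a.

Let hs : is_strategy D a. Proof. by case: ha. Qed.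

Lemma adm_state k l : filtk D k [set w | state a k w = l].
Proof.
apply: (state_measurable hs) => m; have [_ h _ _] := ha.
rewrite (_ : [set w | _] = [set _ | j = m]); first exact: G_const (sG k) _.
by apply/seteqP; split => w /=; have [_ ->] := h w.
Qed.

Lemma adm_finite : {ae P, forall w, (cumcost D a n w < +oo)%E}.
Proof.
have [_ _ _ fin] := ha.
have mA := cumcost_measurable hs (leqnn n).
have m2 : measurable_fun setT (fun w => cumcost D a n w ^+ 2)%E.
  by under eq_fun do rewrite expe2; exact: emeasurable_funM.
have i2 : P.-integrable setT (fun w => cumcost D a n w ^+ 2)%E.
  apply/integrableP; split => //; apply: le_lt_trans fin.
  apply: ge0_le_integral_ae => [//|w|]; first by rewrite sqre_ge0.
  by apply: nearW => w; rewrite gee0_abs// sqre_ge0.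
have := integrable_ae measurableT i2; apply: filterS => w /(_ I).
by case: (cumcost D a n w) => // r _; rewrite ltry.
Qed.

Lemma adm_run : {ae P, forall w, exists N, forall k, (k <= n)%N ->
  state a k w = rr a w k.+1 N /\ cumcost D a k w = (rc a w k.+1 N)%:E}.
Proof.
have [nd _ _] := hs.
apply: filterS2 adm_finite path_good => w fin [c0 ce ct].
have cge := path_good_ge0 c0 ce.
have [N hN] := @finite_switches _ _ (fun r => sw_time a r w) (fun r => regime a r w)
  (c w) n eps eps_gt0 (fun s _ hsn => cge _ _ _ hsn)
  (fun s _ hsn ne => ce _ _ _ hsn (introN eqP (not_eq_sym ne))) fin.
exists N => k kn; split; last exact: cumcost_run.
apply: state_run => // s Ns sk; apply: hN => //; exact: leq_trans kn.
Qed.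

(** By the triangle inequality at a reflection time; at other times the
    strategy is not allowed to switch. *)
Lemma adm_jump k : (k < n)%N -> {ae P, forall w,
  if refl_time D (t k.+1) then
    (c w k.+1 (state a k w) (state a k.+1 w) <= cumcostR D a k.+1 w - cumcostR D a k w : Prop)
  else state a k.+1 w = state a k w /\ cumcostR D a k.+1 w = cumcostR D a k w}.
Proof.
move=> kn; have [nd _ _] := hs; have [_ _ hr _] := ha.
apply: filterS2 adm_run path_good => w [N hN] [c0 ce ct].
have [s1 a1] := hN _ kn; have [s2 a2] := hN _ (ltnW kn).
rewrite /cumcostR a1 a2 s1 s2 /=; case: ifPn => hk.
  apply: run_cost_ge => [r|l|l m p]; [exact: nd|exact: c0|exact: path_good_tri].
apply: run_const => s s_gt0 sk; move: hk; rewrite -sk hr//.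
by rewrite sk.
Qed.

(** The analogue of [adm_jump] at the initial index, where j plays the role of
    the previous state. *)
Lemma adm_jump_init : {ae P, forall w,
  if refl_time D (t i) then (c w i j (state a i w) <= cumcostR D a i w : Prop)
  else state a i w = j /\ cumcostR D a i w = 0}.
Proof.
have [nd _ _] := hs; have [_ h0 hr _] := ha.
apply: filterS2 adm_run path_good => w [N hN] [c0 ce ct].
have [s1 a1] := hN _ hi.
have [ti rj] := h0 w.
have mono := th_mono (th := fun r => sw_time a r w) (fun r => nd r w).
have ri : rr a w i N = j.
  rewrite (@run_regime_last _ _ _ (fun r => nd r w) _ _ 0)// => _.
  by rewrite -[X in (X <= _)%N]ti; exact: nd.
have ci : rc a w i N = 0.
  rewrite /run_cost big_pred0// => s; apply/negbTE; rewrite -leqNgt -[X in (X <= _)%N]ti.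
  exact: (mono 0%N).
rewrite /cumcostR a1 s1 /=; case: ifPn => hk.
  have := @run_cost_ge _ _ (fun r => sw_time a r w) (fun r => regime a r w) (c w)
    (fun r => nd r w) i N (fun l => c0 i l hi)
    (fun l m p => path_good_tri c0 ct l m p hi).
  by rewrite ri ci subr0.
have := @run_const _ _ (fun r => sw_time a r w) (fun r => regime a r w) (c w) i N.
rewrite ri ci; apply => s s_gt0 sk; move: hk; rewrite -sk hr//.
by rewrite sk.
Qed.

Lemma cumcostR_measurable k : (k <= n)%N -> measurable_fun setT (cumcostR D a k).
Proof.
move=> kn; apply: (measurableT_comp _ (cumcost_measurable hs kn)).
exact: fine_measurable.
Qed.

Lemma cumcostR_L1 k : (k <= n)%N -> L1 P (cumcostR D a k).
Proof.
move=> kn.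
have iA : L1 P (cumcostR D a n).
  apply: L1_of_sqr; first exact: cumcostR_measurable.
  have [_ _ _ fin] := ha; apply: le_lt_trans fin.
  apply: ge0_le_integral_ae => [w|w|].
  - by rewrite lee_fin sqr_ge0.
  - by rewrite sqre_ge0.
  - by apply: filterS adm_run => w [N /(_ _ (leqnn n))[_ e]]; rewrite /cumcostR e /= EFin_expe.
apply: (L1_dom (cumcostR_measurable kn) iA).
apply: filterS2 adm_run path_good => w [N hN] [c0 ce ct].
have [_ a1] := hN _ kn; have [_ a2] := hN _ (leqnn n).
have cge := path_good_ge0 c0 ce.
rewrite /cumcostR a1 a2 /=.
have kn' : (k.+1 <= n.+1)%N by [].
have := @run_cost_mono _ _ (fun r => sw_time a r w) (fun r => regime a r w) (c w) _ _ N kn'.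
have h s : (1 <= s)%N -> (sw_time a s w < n.+1)%N ->
   0 <= c w (sw_time a s w) (regime a s.-1 w) (regime a s w) by move=> _ sn; exact: cge.
by move=> /(_ h) /andP[h1 h2]; rewrite ger0_norm.
Qed.


Local Notation U := (Uswitch P D a).
Local Notation dU k := (fun w => U k.+1 w - cumcostR D a k.+1 w + cumcostR D a k w).

Lemma state_indic (f : 'I_d -> Omega -> R) k w :
  f (state a k w) w = \sum_l f l w * \1_[set w | state a k w = l] w.
Proof.
rewrite (bigD1 (state a k w))//= indicE mem_set// mulr1 big1 ?addr0// => l lw.
by rewrite indicE memNset ?mulr0// => /= e; rewrite e eqxx in lw.
Qed.

Lemma state_L1 (f : 'I_d -> Omega -> R) k : (forall l, L1 P (f l)) ->
  L1 P (fun w => f (state a k w) w).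
Proof.
move=> hf; under eq_fun do rewrite state_indic.
apply: L1_sum => l _; apply: L1_indic => //.
by apply: (@mG k); exact: adm_state.
Qed.

Lemma Uswitch_L1 k : (k <= n)%N -> L1 P (U k).
Proof.
move=> kn; have [q qE] : exists q, (q + k = n)%N by exists (n - k)%N; rewrite subnK.
elim: q k kn qE => [|q IH] k kn qE.
  move: qE; rewrite add0n => ->.
  apply: (L1_ext (X := fun w => xi w (state a n w) 0)) => [w|].
    by rewrite Uswitch_n.
  by apply: (state_L1 (f := fun l w => xi w l 0)) => l; exact: xi_L1.
have kn' : (k < n)%N by rewrite -qE addSn ltnS leq_addl.
have idU : L1 P (dU k).
  apply: L1D; last exact: cumcostR_L1.
  apply: L1B; last exact: cumcostR_L1.
  by apply: IH => //; rewrite addnS -addSn.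
apply: (L1_ext (X := fun w => condexp P (filtk D k) (dU k) w +
   step D k * F k w (mx_of_row (state a k w) (EH k (dU k) w)) (state a k w) 0)) => [w|].
  by rewrite UswitchE.
apply: L1D; first exact: condexp_L1.
apply: (state_L1 (f := fun l w => step D k * F k w (mx_of_row l (EH k (dU k) w)) l 0)) => l.
exact: step_driver_L1.
Qed.

Lemma dU_L1 k : (k < n)%N -> L1 P (dU k).
Proof.
move=> kn; apply: L1D; last exact/cumcostR_L1/ltnW.
by apply: L1B; [exact: Uswitch_L1|exact: cumcostR_L1].
Qed.

(** Comparison of the switched scheme with the reflected one along the state
    of the strategy: on the event that the state is l, which belongs to the
    sigma-algebra of the step, both steps use the l-th driver. *)
Lemma switched_step_le k : (k < n)%N ->
  {ae P, forall w, dU k w <= Yr k.+1 w (state a k w) 0} ->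
  {ae P, forall w, U k w <= Yt k w (state a k w) 0}.
Proof.
move=> kn hk.
have h l : {ae P, forall w, [set w | state a k w = l] w -> U k w <= Yt k w l 0}.
  have := @one_step_comparison _ _ _ P _ (sG k) (@mG k) _ _
    (fun p => weight_measurable p kn) _ _ (ltW (step_gt0 hgrids kn)) (hHbound kn)
    _ (hFlip kn) (dU k) (fun w => Yr k.+1 w l 0) _ l (dU_L1 kn) (Yrefl_L1 l kn) (adm_state k l).
  set Q := (X in (X -> _) -> _); have q : Q.
    by rewrite /Q; apply: filterS hk => w hw /= <-.
  move=> /(_ q); apply: filterS2 (Ytilde_ae l kn) => w e hw sl.
  rewrite e; apply: le_trans (hw sl); rewrite UswitchE//.
  by rewrite /= in sl; rewrite sl.
by apply: filterS (ae_forall_count h) => w hw; exact: hw.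
Qed.

Lemma switched_step_ge k : (k < n)%N ->
  {ae P, forall w, Yr k.+1 w (state a k w) 0 <= dU k w} ->
  {ae P, forall w, Yt k w (state a k w) 0 <= U k w}.
Proof.
move=> kn hk.
have h l : {ae P, forall w, [set w | state a k w = l] w -> Yt k w l 0 <= U k w}.
  have := @one_step_comparison _ _ _ P _ (sG k) (@mG k) _ _
    (fun p => weight_measurable p kn) _ _ (ltW (step_gt0 hgrids kn)) (hHbound kn)
    _ (hFlip kn) (fun w => Yr k.+1 w l 0) (dU k) _ l (Yrefl_L1 l kn) (dU_L1 kn) (adm_state k l).
  set Q := (X in (X -> _) -> _); have q : Q.
    by rewrite /Q; apply: filterS hk => w hw /= <-.
  move=> /(_ q); apply: filterS2 (Ytilde_ae l kn) => w e hw sl.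
  rewrite e; apply: (le_trans (hw sl)); rewrite UswitchE//.
  by rewrite /= in sl; rewrite sl.
by apply: filterS (ae_forall_count h) => w hw; exact: hw.
Qed.

End Admissible.

(** There is no projection at the last index, but there the terminal value
    lies in the domain of its cost and is its own projection. *)
Lemma obstacle : {ae P, forall w, forall k, (k <= n)%N ->
  if refl_time D (t k) then
     (forall l m, switch_value P D k w l m <= Yr k w l 0) /\
     (forall l, exists m, Yr k w l 0 = switch_value P D k w l m)
  else forall l, Yr k w l 0 = Yt k w l 0}.
Proof.
have [_ _ hQ] := hxi; have [[_ tn _] _ _] := hgrids.
apply: filterS2 path_good hQ => w [c0 _ _] hq k; rewrite leq_eqVlt => /predU1P[->|kn].
  rewrite Yrefl_n; case: ifP => hk; last by move=> l; rewrite Ytilde_n.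
  split=> [l m|l].
    apply: le_trans (hq l); rewrite /switch_value Ytilde_n tn /omax.
    exact: le_bigmax.
  exists l; rewrite /switch_value Ytilde_n.
  by have := c0 n l (leqnn n); rewrite /path_cost => ->; rewrite subr0.
case: ifP => hk; last by move=> l; rewrite YreflE// hk.
split=> [l m|l]; rewrite YreflE// hk mxE /omax.
  exact: le_bigmax.
have : \big[Num.max/Yt k w l 0 - C (t k) w l l]_(m < d) (Yt k w m 0 - C (t k) w l m)
   \in [set x | exists m, x = switch_value P D k w l m].
  elim/big_rec : _ => [|m x _].
    by rewrite inE; exists l.
  rewrite !inE => -[p ->]; rewrite maxEge; case: ifP => _; by [exists m|exists p].
by rewrite inE.
Qed.

Lemma switched_le i j a : (i <= n)%N -> admissible P D i j a ->
  forall k, (i <= k <= n)%N ->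
  {ae P, forall w, Uswitch P D a k w <= Yt k w (state a k w) 0}.
Proof.
move=> hi ha k /andP[ik kn].
have [q qE] : exists q, (q + k = n)%N by exists (n - k)%N; rewrite subnK.
elim: q k ik kn qE => [|q IH] k ik kn qE.
  move: qE; rewrite add0n => ->; apply: nearW => w.
  by rewrite Uswitch_n Ytilde_n.
have kn' : (k < n)%N by rewrite -qE addSn ltnS leq_addl.
apply: (switched_step_le ha kn').
have {}IH : {ae P, forall w, Uswitch P D a k.+1 w <= Yt k.+1 w (state a k.+1 w) 0}.
  by apply: IH; rewrite ?leqW// addnS -addSn.
apply: filterS3 IH (adm_jump ha kn') obstacle => w h1 h2 /(_ _ kn').
case: ifP h2 => hk h2.
  move=> [/(_ (state a k w) (state a k.+1 w)) h3 _]; move: h1 h2 h3.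
  rewrite /switch_value /path_cost; lra.
by case: h2 h1 => -> -> h1 ->; lra.
Qed.

Lemma value_le i j a : (i <= n)%N -> admissible P D i j a ->
  {ae P, forall w, Uswitch P D a i w - cumcostR D a i w <= Yr i w j 0}.
Proof.
move=> hi ha.
have ii : (i <= i <= n)%N by rewrite leqnn.
apply: filterS3 (switched_le hi ha ii) (adm_jump_init hi ha) obstacle => w h1 h2 /(_ _ hi).
case: ifP h2 => hk h2.
  move=> [/(_ j (state a i w)) h3 _]; move: h1 h2 h3.
  rewrite /switch_value /path_cost; lra.
by case: h2 h1 => -> -> h1 ->; lra.
Qed.


(** * The greedy strategy *)

Lemma must_switch_measurable k l : (k <= n)%N ->
  filtk D k [set w | must_switch P D k w l].
Proof.
move=> kn; rewrite (_ : [set w | _] = [set _ | refl_time D (t k)] `&`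
   [set w | exists m : 'I_d, ([set _ | m != l] `&`
      [set w | Yt k w l 0 <= switch_value P D k w l m]) w]).
  apply: (G_setI (sG k)); first exact: G_const (sG k) _.
  apply: (G_exists (sG k)) => m; apply: (G_setI (sG k)); first exact: G_const (sG k) _.
  apply: (G_ler (sG k)); first exact: Ytilde_measurable.
  exact: switch_value_measurable.
apply/seteqP; split => w /=; rewrite /must_switch.
  by move=> /andP[-> /existsP[m /andP[h1 h2]]]; split => //; exists m.
by move=> [-> [m [h1 h2]]]; apply/existsP; exists m; rewrite h1.
Qed.

Lemma next_time_le_measurable th l k : filtk D k [set w | (next_time P D w th l <= k)%N].
Proof.
have [kn|nk] := leqP k n; last first.
  rewrite (_ : [set w | _] = setT); first exact: G_setT (sG k).
  by apply/seteqP; split => w //= _; apply: leq_trans (next_time_le _ _ _ _ _) nk.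
rewrite (_ : [set w | _] = [set w | exists m : 'I_k.+1,
   ([set _ | (th <= m)%N] `&` [set w | must_switch P D m w l]) w]).
  apply: (G_exists (sG k)) => m; apply: (G_setI (sG k)); first exact: G_const (sG k) _.
  have mk : (m <= k)%N by rewrite -ltnS.
  by apply: (Gle mk); apply: must_switch_measurable; exact: leq_trans mk kn.
apply/seteqP; split => w /=.
  move=> h; have [h1 h2] := next_time_in (leq_trans h kn).
  have hk : (next_time P D w th l < k.+1)%N by rewrite ltnS.
  by exists (Ordinal hk).
move=> [m [h1 h2]]; have mk : (m <= k)%N by rewrite -ltnS.
by apply: (leq_trans _ mk); apply: next_time_min => //; rewrite h1 (leq_trans mk).
Qed.

Lemma next_time_eq_measurable th l k : filtk D k [set w | next_time P D w th l = k].
Proof.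
rewrite (_ : [set w | _] = [set w | (next_time P D w th l <= k)%N] `&`
    ~` (if k is k'.+1 then [set w | (next_time P D w th l <= k')%N] else set0)).
  apply: (G_setI (sG k)); first exact: next_time_le_measurable.
  apply: (G_setC (sG k)); case: k => [|k]; first by have [] := sG 0.
  by apply: (Gle (leqnSn k)); exact: next_time_le_measurable.
by apply/seteqP; case: k => [|k]; split => w /=; lia.
Qed.

(** The selected regime is a function of finitely many Boolean comparisons of
    switch values, each of which is an event of the step. *)
Lemma next_regime_measurable k l m : filtk D k [set w | next_regime P D w k l = m].
Proof.
have [kn|nk] := leqP k n; last first.
  rewrite (_ : [set w | _] = [set _ | l = m]); first exact: G_const (sG k) _.
  by apply/seteqP; split => w /=; rewrite /next_regime leqNgt nk.
pose b w := [ffun q : 'I_d => [forall p : 'I_d, (p != l) ==>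
   (switch_value P D k w l p <= switch_value P D k w l q)]].
pose g (f : {ffun 'I_d -> bool}) : 'I_d :=
  arg_min l (fun q => (q != l) && f q) (fun q : 'I_d => q : nat).
have -> : [set w | next_regime P D w k l = m] = [set w | g (b w) = m].
  apply/seteqP; split => w /=; rewrite /next_regime kn /g => <-; congr (arg_min _ _ _);
    apply/funext => q; rewrite ffunE; have [//|ql] := eqVneq q l;
    by rewrite /= best_switch_eq.
apply: (@G_finite _ _ _ (sG k) _ b (fun f => g f = m)) => f.
rewrite (_ : [set w | _] = [set w | forall q, [set w | b w q = f q] w]); last first.
  by apply/seteqP; split => w /= h; [rewrite h|apply/ffunP].
apply: (G_forall (sG k)) => q.
have hq : filtk D k [set w | b w q].
  rewrite (_ : [set w | _] = [set w | forall p : 'I_d, (if p != l then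
     [set w | switch_value P D k w l p <= switch_value P D k w l q] else setT) w]).
    apply: (G_forall (sG k)) => p; case: ifP => _; last exact: G_setT (sG k).
    by apply: (G_ler (sG k)); exact: switch_value_measurable.
  apply/seteqP; split => w /=; rewrite ffunE.
    by move=> /forall_inP h p; case: ifP => //= pl; exact: h.
  by move=> h; apply/forall_inP => p pl; have := h p; rewrite pl.
case: (f q); first by [].
rewrite (_ : [set w | _] = ~` [set w | b w q]); first exact: (G_setC (sG k)).
by apply/seteqP; split => w /=; [move=> ->|move=> /negP/negbTE].
Qed.

Section Optimal.
Variables (i : nat) (j : 'I_d).
Hypothesis hi : (i <= n)%N.
Local Notation opt := (opt_strategy P D i j).

Lemma opt_pair_measurable r m l :
  filtk D m [set w | sw_time opt r w = m /\ regime opt r w = l].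
Proof.
elim: r m l => [|r IH] m l.
  exact: G_const (sG m) (i = m /\ j = l).
rewrite (_ : [set w | _] = [set w | exists x : 'I_m.+1 * 'I_d,
  ([set w | sw_time opt r w = x.1 /\ regime opt r w = x.2] `&`
   ([set w | next_time P D w x.1 x.2 = m] `&` [set w | next_regime P D w m x.2 = l])) w]).
  apply: (G_exists (sG m)) => -[p q] /=.
  have pm : (p <= m)%N by rewrite -ltnS.
  apply: (G_setI (sG m)); first by apply: (Gle pm); exact: IH.
  apply: (G_setI (sG m)); first exact: next_time_eq_measurable.
  exact: next_regime_measurable.
apply/seteqP; split => w.
  move=> [h1 h2].
  have hm : (sw_time opt r w < m.+1)%N by rewrite ltnS -h1; exact: opt_time_nd.
  exists (Ordinal hm, regime opt r w); split=> //=; split; first exact: h1.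
  by rewrite /= -h1.
move=> [[p q] [/= [h1 h2] [h3 h4]]].
rewrite /= in h3 h4.
change (next_time P D w (sw_time opt r w) (regime opt r w) = m /\
  next_regime P D w (next_time P D w (sw_time opt r w) (regime opt r w))
    (regime opt r w) = l).
by rewrite [sw_time _ _ _]h1 [regime _ _ _]h2 h3.
Qed.

Lemma opt_is_strategy : is_strategy D opt.
Proof.
have le_of r k (Q : set 'I_d) :
    filtk D k [set w | (sw_time opt r w <= k)%N /\ Q (regime opt r w)].
  rewrite (_ : [set w | _] = [set w | exists x : 'I_k.+1 * 'I_d,
     ([set w | sw_time opt r w = x.1 /\ regime opt r w = x.2] `&` [set _ | Q x.2]) w]).
    apply: (G_exists (sG k)) => -[p q]; apply: (G_setI (sG k)); last exact: G_const (sG k) _.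
    have pk : (p <= k)%N by rewrite -ltnS.
    by apply: (Gle pk); exact: opt_pair_measurable.
  apply/seteqP; split => w.
    move=> [h1 h2]; have hm : (sw_time opt r w < k.+1)%N by [].
    by exists (Ordinal hm, regime opt r w).
  by move=> [[p q] [[/= h1 <-] h3]]; split => //; rewrite h1 -ltnS.
split=> [r w|r k|r l k]; first exact: opt_time_nd.
- have := le_of r k setT; congr (filtk D k _); apply/seteqP; split => w //= [] //.
- have := le_of r k [set l]; congr (filtk D k _).
  by apply/seteqP; split => w [].
Qed.

Local Notation N := n.+2.

Lemma opt_run : {ae P, forall w, forall k, (k <= n)%N ->
  state opt k w = rr opt w k.+1 N /\ cumcost D opt k w = (rc opt w k.+1 N)%:E}.
Proof.
apply: filterS path_good => w [c0 ce ct] k kn.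
have late s : (N < s)%N -> (sw_time opt s w <= n)%N -> regime opt s w = regime opt s.-1 w.
  move=> Ns sn; have := @opt_time_gt _ _ _ P _ D i j w hi c0 ct s (ltnW Ns); by rewrite ltnNge sn.
split; last exact: cumcost_run.
apply: state_run => [r|s Ns sk]; first exact: opt_time_nd.
by apply: late => //; exact: leq_trans kn.
Qed.

(** At most n + 2 switches, each of them paid at a reflection time, where the
    cost matrix is square integrable. *)
Lemma opt_cost_fin : (\int[P]_w (cumcost D opt n w ^+ 2) < +oo)%E.
Proof.
pose S w : R := \sum_(k < n.+1 | refl_time D (t k)) enorm (C (t k) w) ^+ 2.
have iS : L1 P S.
  apply: L1_sum => k hk; apply/integrableP; split.
    apply/measurable_EFinP; apply: enorm_measurable => p q.
    by apply: (measurable_wrt_fun (@mG k)); apply: cost_measurable; rewrite -ltnS.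
  apply: le_lt_trans (cost_sqr_fin (k := k) _ hk); last by rewrite -ltnS.
  apply: ge0_le_integral_ae => [//|w|]; first by rewrite lee_fin sqr_ge0.
  by apply: nearW => w /=; rewrite lee_fin ger0_norm ?sqr_ge0.
have S0 w : 0 <= S w by apply: sumr_ge0 => k _; exact: sqr_ge0.
have [_] := integrableP _ _ _ (L1Z (N%:R ^+ 2) iS); apply: le_lt_trans.
apply: ge0_le_integral_ae => [w|//|]; first exact: sqre_ge0.
apply: filterS2 opt_run path_good => w hw [c0 ce ct].
have [_ ->] := hw _ (leqnn n).
rewrite -EFin_expe lee_fin ger0_norm; last by rewrite mulr_ge0 ?sqr_ge0.
have hb : `|rc opt w n.+1 N| <= N%:R * Num.sqrt (S w).
  rewrite /run_cost big_mkcond (le_trans (ler_norm_sum _ _ _))//.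
  apply: (@le_trans _ _ (\sum_(1 <= s < N.+1) Num.sqrt (S w))); last first.
    by rewrite sumr_const_nat subn1 mulr_natl.
  rewrite big_nat_cond [leRHS]big_nat_cond; apply: ler_sum => s /andP[/andP[s1 _] _].
  case: ifPn => [sn|_]; last by rewrite normr0 sqrtr_ge0.
  have hsw : refl_time D (t (sw_time opt s w)).
    by case: s s1 sn => // s _ sn; have /andP[] := opt_switch sn.
  apply: (le_trans (ler_enorm _ _ _)).
  rewrite ler_sqrt ?S0// -enorm_sqr.
  rewrite /S (bigD1 (Ordinal sn))//= lerDl.
  by apply: sumr_ge0 => k _; exact: sqr_ge0.
rewrite -(real_normK (num_real _)) (le_trans (_ : _ <= (N%:R * Num.sqrt (S w)) ^+ 2))//.
  by rewrite lerXn2r ?nnegrE ?mulr_ge0 ?sqrtr_ge0.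
by rewrite exprMn sqr_sqrtr.
Qed.

Lemma opt_admissible : admissible P D i j opt.
Proof.
split; [exact: opt_is_strategy|by []| |exact: opt_cost_fin].
by case=> // r w _ rn; have /andP[] := opt_switch rn.
Qed.

Lemma opt_jump k : (i <= k)%N -> (k < n)%N -> {ae P, forall w,
  Yt k.+1 w (state opt k.+1 w) 0 - (cumcostR D opt k.+1 w - cumcostR D opt k w) =
  Yr k.+1 w (state opt k w) 0}.
Proof.
move=> ik kn; apply: filterS3 opt_run path_good obstacle => w h1 [c0 ce ct] h3.
have [s1 a1] := h1 _ kn; have [s2 a2] := h1 _ (ltnW kn).
rewrite /cumcostR a1 a2 s1 s2 /=.
apply: (@opt_run_step _ _ _ P _ D i j w hi c0 ct k.+1 (fun l => Yr k.+1 w l 0)).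
  by rewrite (leq_trans ik (leqnSn k)).
exact: h3.
Qed.

Lemma opt_jump_init : {ae P, forall w,
  Yt i w (state opt i w) 0 - cumcostR D opt i w = Yr i w j 0}.
Proof.
apply: filterS3 opt_run path_good obstacle => w h1 [c0 ce ct] h3.
have [s1 a1] := h1 _ hi; rewrite /cumcostR a1 s1 /=.
have nd r : (sw_time opt r w <= sw_time opt r.+1 w)%N by exact: opt_time_nd.
have mono := th_mono (th := fun r => sw_time opt r w) nd.
have ri : rr opt w i N = j.
  by rewrite (@run_regime_last _ _ _ nd _ _ 0)// => _; exact: (mono 0%N).
have ci : rc opt w i N = 0.
  rewrite /run_cost big_pred0// => s; apply/negbTE; rewrite -leqNgt.
  exact: (mono 0%N).
have := @opt_run_step _ _ _ P _ D i j w hi c0 ct i (fun l => Yr i w l 0).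
by rewrite leqnn hi ri ci subr0; apply => //; exact: h3.
Qed.

(** The same induction as for the upper bound, with every inequality
    reversed: the greedy strategy pays exactly what the projection
    subtracts. *)
Lemma opt_ge k : (i <= k <= n)%N ->
  {ae P, forall w, Yt k w (state opt k w) 0 <= Uswitch P D opt k w}.
Proof.
move=> /andP[ik kn].
have [q qE] : exists q, (q + k = n)%N by exists (n - k)%N; rewrite subnK.
elim: q k ik kn qE => [|q IH] k ik kn qE.
  move: qE; rewrite add0n => ->; apply: nearW => w.
  by rewrite Uswitch_n Ytilde_n.
have kn' : (k < n)%N by rewrite -qE addSn ltnS leq_addl.
apply: (switched_step_ge opt_admissible kn').
have {}IH : {ae P, forall w, Yt k.+1 w (state opt k.+1 w) 0 <= Uswitch P D opt k.+1 w}.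
  by apply: IH; rewrite ?leqW// addnS -addSn.
by apply: filterS2 IH (opt_jump ik kn') => w h1 h2; lra.
Qed.

Lemma opt_value_ge : {ae P, forall w,
  Yr i w j 0 <= Uswitch P D opt i w - cumcostR D opt i w}.
Proof.
have ii : (i <= i <= n)%N by rewrite leqnn.
by apply: filterS2 (opt_ge ii) opt_jump_init => w h1 h2; lra.
Qed.

End Optimal.
End Schemes.

(** * The Snell envelope representation *)

Unset Implicit Arguments.

Theorem proposition3p3 (R : realType) (disp : measure_display)
  (Omega : measurableType disp) (P : probability Omega R)
  (T : R) (hT : 0 < T) (d : nat) (hd : (1 <= d)%N)
  (W : R -> Omega -> 'rV[R]_d) (hW : brownian_motion P T W)
  (D : scheme_data R Omega d) (hfilt : brownian_filtration P T W (filt D))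
  (hgrids : grids_ok T D)
  (hC : cost_process P T D) (hxi : terminal_ok P T D)
  (lambda Lambda : R) (lam : nat -> R) (hH : weights_ok P D lambda Lambda lam)
  (hFmeas : driver_measurable D)
  (eps : R) (hCstruct : cost_structure P T D eps)
  (hFdiag : driver_diagonal P D)
  (LZ : R) (hFlip : driver_lipschitz P D LZ)
  (Cp : R) (hmom : moment_bound P D Cp)
  (hHbound : weights_bounded P D LZ)
  (j : 'I_d) (i : nat) (hi : (i <= nsteps D)%N) :
  [/\ forall a : strategy Omega d, admissible P D i j a ->
        {ae P, forall w, Uswitch P D a i w - cumcostR D a i w <= Yrefl P D i w j 0},
      admissible P D i j (opt_strategy P D i j) /\
      {ae P, forall w, Yrefl P D i w j 0 =
         Uswitch P D (opt_strategy P D i j) i w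
         - cumcostR D (opt_strategy P D i j) i w} &
      is_ess_sup_family P
        [set (fun w => (Uswitch P D a i w - cumcostR D a i w)%:E)
           | a in [set a | admissible P D i j a]]
        (fun w => (Yrefl P D i w j 0)%:E)].
Proof.
have upper a (ha : admissible P D i j a) := value_le hW hfilt hgrids hC hxi hH
  hFmeas hCstruct hFdiag hFlip hmom hHbound hi ha.
have opt_adm := opt_admissible hW hfilt hgrids hC hxi hFmeas hCstruct hmom j hi.
have lower := opt_value_ge hW hfilt hgrids hC hxi hH hFmeas hCstruct hFdiag
  hFlip hmom hHbound j hi.
have attained : {ae P, forall w, Yrefl P D i w j 0 =
    Uswitch P D (opt_strategy P D i j) i w
    - cumcostR D (opt_strategy P D i j) i w}.
  by apply: filterS2 (upper _ opt_adm) lower => w h1 h2; apply: le_anti; rewrite h1 h2.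
split; [exact: upper|by split|split].
- apply/measurable_EFinP.
  exact: (measurable_wrt_fun (@filtk_meas _ _ _ _ _ _ _ _ hW hfilt hgrids i)
    (Yrefl_measurable hfilt hgrids hC hxi hFmeas hi j 0)).
- by move=> _ [a ha <-]; apply: filterS (upper a ha) => w; rewrite lee_fin.
- move=> X' _ /(_ _ (ex_intro2 _ _ _ opt_adm erefl)).
  by apply: filterS2 attained => w ->.
Qed.
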